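(* For each integer $k\ge 10$ consider the Hegselmann--Krause system with $n=3k+1$ non-strategic agents (the dumbbell configuration) in which (1) $k$ agents have starting opinion $-\frac{1}{k}$, (2) one agent has starting opinion $i$ for each integer $0\le i\le k$, and (3) $k$ agents have starting opinion $k+\frac{1}{k}$. As $k\to\infty$, the convergence time of this system without strategic agents ($m=0$) is in $\Omega(n^2)$, while its optimal convergence time for $m=1$ strategic agent is in $O\left(n^{3/4}\right)$.
   Context: One-dimensional Hegselmann--Krause (HK) system with strategic agents: there is a set $N=\{1,\dots,n\}$ of non-strategic agents and a disjoint set $S$ of $m=|S|$ strategic agents; $A=N\cup S$. At each discrete time $t\in\mathbb{N}_{\ge 0}$ every agent $i\in A$ has an opinion $x_i(t)\in\mathbb{R}$. The starting opinions $x_i(0)$, $i\in N$, are given. The opinions $x_s(t)$ of the strategic agents $s\in S$ can be chosen freely (as any real numbers) at every time $t$. For $i\in N$, $$x_i(t+1)=\frac{1}{|\mathcal{N}_i(t)|}\sum_{j\in\mathcal{N}_i(t)}x_j(t),\qquad \mathcal{N}_i(t)=\{j\in A: |x_i(t)-x_j(t)|\le 1\}.$$ The system has converged at time $t$ if for all $i,j\in N$ either $x_i(t)=x_j(t)$ or $|x_i(t)-x_j(t)|>1$. The convergence time is the smallest $t\in\mathbb{N}_{\ge 0}$ such that the system has converged at time $t$. For given starting opinions of the non-strategic agents and given $m$, the optimal convergence time is the minimum of the convergence time over all choices of the opinions of the $m$ strategic agents at all times. *)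

(* Defs.v *)
From mathcomp Require Import all_boot all_order all_algebra.
From mathcomp Require Import all_classical all_reals all_analysis.

Set Implicit Arguments.
Unset Strict Implicit.
Unset Printing Implicit Defensive.

Import Order.TTheory GRing.Theory Num.Theory.
Import numFieldNormedType.Exports.

Local Open Scope ring_scope.

Section HegselmannKrause.
Variable R : realType.

(* The agent set is the disjoint union 'I_n + 'I_m: [inl] injects the
   non-strategic agents and [inr] the strategic ones. *)
Definition profile (n m : nat) (x : 'I_n -> R) (y : 'I_m -> R)
    (a : 'I_n + 'I_m) : R :=
  match a with inl i => x i | inr s => y s end.

Definition neighbours (n m : nat) (z : 'I_n + 'I_m -> R) (i : 'I_n) :
    {set 'I_n + 'I_m} :=
  [set a | `|z (inl i) - z a| <= 1].

Definition hk_step (n m : nat) (z : 'I_n + 'I_m -> R) (i : 'I_n) : R :=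
  (#|neighbours z i|%:R)^-1 * \sum_(a in neighbours z i) z a.

(* The opinions of the strategic agents at all times. As the dynamics is
   deterministic, choosing them as a function of time alone is no restriction
   with respect to letting them depend on the past. *)
Definition strategy (m : nat) := nat -> 'I_m -> R.

Fixpoint opinions (n m : nat) (x0 : 'I_n -> R) (u : strategy m) (t : nat) :
    'I_n -> R :=
  if t is t'.+1 then hk_step (profile (opinions x0 u t') (u t')) else x0.

Definition converged (n : nat) (x : 'I_n -> R) : Prop :=
  forall i j : 'I_n, x i = x j \/ 1 < `|x i - x j|.

Definition is_convergence_time (n m : nat) (x0 : 'I_n -> R) (u : strategy m)
    (T : nat) : Prop :=
  converged (opinions x0 u T) /\
  forall t : nat, converged (opinions x0 u t) -> (T <= t)%N.

(* Strategies under which the system never converges have no convergence time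
   and so do not compete in the minimum. *)
Definition is_optimal_convergence_time (n m : nat) (x0 : 'I_n -> R) (T : nat) :
    Prop :=
  (exists u : strategy m, is_convergence_time x0 u T) /\
  forall (u : strategy m) (T' : nat),
    is_convergence_time x0 u T' -> (T <= T')%N.

(* 'I_0 is empty, so this is the only element of [strategy 0] up to
   extensionality. *)
Definition no_strategic_agent : strategy 0 := fun _ _ => 0.

Definition dumbbell (k : nat) (i : 'I_(3 * k + 1)) : R :=
  if (i < k)%N then - k%:R^-1
  else if (i <= 2 * k)%N then (i - k)%N%:R
  else k%:R + k%:R^-1.

End HegselmannKrause.

Arguments no_strategic_agent {R}.
Arguments is_optimal_convergence_time {R n} m x0 T.
Arguments dumbbell R k i : clear implicits.

(* Main.v *)
Require Import Defs.
From mathcomp Require Import all_boot all_order all_algebra.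
From mathcomp Require Import all_classical all_reals all_analysis.
From mathcomp Require Import ring lra zify.
Import Order.TTheory GRing.Theory Num.Theory.
Import numFieldNormedType.Exports.
Local Open Scope classical_set_scope.
Local Open Scope ring_scope.

(** Without strategic agent, write x for the position of the first cluster, a for its
distance to agent 0 of the chain and 1 - e_i for the gaps of the chain.  As long as
the communication graph is the initial one, a stays at about 1/k while e solves a
discrete heat equation with an influx of order 1/k^2 at both ends, so that e_0 < a,
and the graph is unchanged, for c k^2 steps (comparison with an explicit
supersolution; the configuration stays symmetric).

With one strategic agent, let l = k^(1/4).  Placed half-way between the agents c and
c + 1 of the undisturbed chain, it draws them together and thereby separates the pair
from the rest of the chain at once.  Doing this at every l-th chain agent, one pair per
step, takes O(k/l) = O(l^3) steps and no disturbance ever reaches the next pair.  What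
is left are the two end clusters, of diameter at most 1, and isolated blocks of O(l)
agents with diameter O(l).  These converge on their own in O(l^3) steps, because in any
two steps the leftmost unfinished agent of a block of M agents moves right by 1/(2M^2)
or its neighbourhood merges and splits off. *)

(** * Averages over unit balls: bounds, reflection and monotonicity in the centre *)

Section BallAverage.
Context {R : realType} {T : finType}.
Implicit Types (z : T -> R) (c v : R).

(** The centre is separate from the family, so that averages at two centres can be compared, with or
    without a strategic agent in the family. The cardinality is written as a sum of ones in [R],
    which lets both factors be handled by the same big-operator lemmas. *)
Definition ball_avg z c : R :=
  (\sum_(a | `|c - z a| <= 1) 1)^-1 * \sum_(a | `|c - z a| <= 1) z a.

Lemma ball_size_ge1 z c a0 :
  `|c - z a0| <= 1 -> 1 <= \sum_(a | `|c - z a| <= 1) (1 : R).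
Proof.
by move=> h; rewrite (bigD1 a0) //= lerDl sumr_ge0.
Qed.

(** The witness [a0] keeps the ball nonempty; the average over an empty ball is 0 by convention and
    the formula would fail. *)
Lemma ball_avg_sub z c v a0 : `|c - z a0| <= 1 ->
  ball_avg z c - v = (\sum_(a | `|c - z a| <= 1) 1)^-1 *
                     \sum_(a | `|c - z a| <= 1) (z a - v).
Proof.
move=> /ball_size_ge1 h.
have W0 : \sum_(a | `|c - z a| <= 1) (1 : R) != 0 by lra.
rewrite sumrB mulrBr /ball_avg; congr (_ - _).
have -> : \sum_(a | `|c - z a| <= 1) v = (\sum_(a | `|c - z a| <= 1) 1) * v.
  by rewrite big_distrl /=; apply: eq_bigr => a _; rewrite mul1r.
by rewrite mulKf.
Qed.

(** After subtracting [v] all terms are nonnegative, so the term of [a0] alone, with weight at least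
    [1/M], bounds the average. This is how a single agent is shown to drag another one along. *)
Lemma ball_avg_ge_weighted z c v (M : R) a0 :
  (forall a, `|c - z a| <= 1 -> v <= z a) -> `|c - z a0| <= 1 ->
  \sum_(a | `|c - z a| <= 1) 1 <= M ->
  v + (z a0 - v) / M <= ball_avg z c.
Proof.
move=> hv h0 hM; have W1 := ball_size_ge1 _ _ _ h0.
rewrite -lerBrDl (ball_avg_sub _ _ v _ h0).
have z0 : 0 <= z a0 - v by rewrite subr_ge0 hv.
apply: (@le_trans _ _ ((z a0 - v) / \sum_(a | `|c - z a| <= 1) 1)).
  by rewrite ler_wpM2l // lef_pV2 // posrE; lra.
rewrite [leLHS]mulrC; apply: ler_wpM2l; first by rewrite invr_ge0; lra.
rewrite [leRHS](bigD1 a0) //= lerDl sumr_ge0 // => a /andP[ha _].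
by rewrite subr_ge0 hv.
Qed.

Lemma ball_avg_ge z c v a0 :
  (forall a, `|c - z a| <= 1 -> v <= z a) -> `|c - z a0| <= 1 ->
  v <= ball_avg z c.
Proof.
move=> hv h0; have W1 := ball_size_ge1 _ _ _ h0.
apply: le_trans (ball_avg_ge_weighted _ _ _ _ _ hv h0 (lexx _)).
by rewrite lerDl divr_ge0 ?subr_ge0 ?hv//; lra.
Qed.

Lemma ball_avgN z c : ball_avg (fun a => - z a) (- c) = - ball_avg z c.
Proof.
have E a : (`|- c - - z a| <= 1) = (`|c - z a| <= 1).
  by rewrite -opprD normrN.
by rewrite /ball_avg (eq_bigl _ _ E) (eq_bigl _ _ E) sumrN mulrN.
Qed.

Lemma ball_avg_le_weighted z c v (M : R) a0 :
  (forall a, `|c - z a| <= 1 -> z a <= v) -> `|c - z a0| <= 1 ->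
  \sum_(a | `|c - z a| <= 1) 1 <= M ->
  ball_avg z c <= v - (v - z a0) / M.
Proof.
move=> hv h0 hM; rewrite -lerN2 -ball_avgN opprB.
have E a : (`|- c - - z a| <= 1) = (`|c - z a| <= 1).
  by rewrite -opprD normrN.
have -> : (v - z a0) / M - v = - v + (- z a0 - - v) / M.
  by rewrite opprK [- z a0 + v]addrC [RHS]addrC.
apply: ball_avg_ge_weighted; rewrite ?E //; last by rewrite (eq_bigl _ _ E).
by move=> a; rewrite E lerN2; apply: hv.
Qed.

Lemma ball_avg_le z c v a0 :
  (forall a, `|c - z a| <= 1 -> z a <= v) -> `|c - z a0| <= 1 ->
  ball_avg z c <= v.
Proof.
move=> hv h0; have W1 := ball_size_ge1 _ _ _ h0.
apply: le_trans (ball_avg_le_weighted _ _ _ _ _ hv h0 (lexx _)) _.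
by rewrite gerBl divr_ge0 ?subr_ge0 ?hv//; lra.
Qed.

Lemma eq_ball_avg z z' c c' :
  (forall a, (`|c - z a| <= 1) = (`|c' - z' a| <= 1)) ->
  (forall a, `|c - z a| <= 1 -> z a = z' a) ->
  ball_avg z c = ball_avg z' c'.
Proof.
move=> E Ez; rewrite /ball_avg -(eq_bigl _ _ E) -(eq_bigl _ _ E).
by congr (_ * _); apply: eq_bigr => a /Ez.
Qed.

(* With balls A of c and B of c' and their averages, |B| sum_A - |A| sum_B is the
   sum of z a - z b over A x B; the pairs of (A :&: B) x (A :&: B) cancel and every
   other pair has a nonpositive difference. *)
Lemma ball_avg_mono z c c' a0 a1 :
  c <= c' -> `|c - z a0| <= 1 -> `|c' - z a1| <= 1 ->
  ball_avg z c <= ball_avg z c'.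
Proof.
move=> cc' h0 h1.
have WA := ball_size_ge1 _ _ _ h0; have WB := ball_size_ge1 _ _ _ h1.
rewrite -subr_le0 (ball_avg_sub _ _ _ _ h0).
rewrite pmulr_rle0 ?invr_gt0; last by lra.
rewrite (eq_bigr (fun a => - (ball_avg z c' - z a))); last by move=> a _; rewrite opprB.
under eq_bigr => a _ do rewrite (ball_avg_sub _ _ _ _ h1).
rewrite sumrN oppr_le0 -mulr_sumr pmulr_rge0 ?invr_gt0; last by lra.
pose A a := `|c - z a| <= 1; pose B a := `|c' - z a| <= 1.
rewrite -/A -/B (bigID B) /=.
have -> : \sum_(a | A a && B a) \sum_(b | B b) (z b - z a) =
   \sum_(a | A a && B a) \sum_(b | A b && B b) (z b - z a) +
   \sum_(a | A a && B a) \sum_(b | B b && ~~ A b) (z b - z a).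
  rewrite -big_split /=; apply: eq_bigr => a _; rewrite (bigID A) /=.
  by congr (_ + _); apply: eq_bigl => b; rewrite andbC.
have -> : \sum_(a | A a && B a) \sum_(b | A b && B b) (z b - z a) = 0.
  set S := LHS; have : S = - S.
    rewrite /S [in LHS]exchange_big /= -sumrN; apply: eq_bigr => a _.
    by rewrite -sumrN; apply: eq_bigr => b _; rewrite opprB.
  by lra.
rewrite add0r addr_ge0 // sumr_ge0 // => a /andP[].
- rewrite /A /B !ler_norml => /andP[Aa1 Aa2] /andP[Ba1 Ba2].
  rewrite sumr_ge0 // => b /andP[]; rewrite ler_norml => /andP[Bb1 Bb2].
  by rewrite ler_norml negb_and -!ltNge => /orP[] ?; lra.
- rewrite /A /B ler_norml => /andP[Aa1 Aa2].
  rewrite ler_norml negb_and -!ltNge => nBa.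
  rewrite sumr_ge0 // => b; rewrite ler_norml => /andP[Bb1 Bb2].
  by case/orP: nBa => ?; lra.
Qed.

End BallAverage.

Lemma hk_step_ball_avg {R : realType} {n m : nat} (z : 'I_n + 'I_m -> R) (i : 'I_n) :
  hk_step z i = ball_avg z (z (inl i)).
Proof.
rewrite /hk_step /ball_avg /neighbours; congr (_^-1 * _).
  rewrite -sum1_card natr_sum /=; apply: eq_bigl => a; by rewrite inE.
by apply: eq_bigl => a; rewrite inE.
Qed.

(** * Single steps on profiles indexed by [nat], and gaps that no step closes *)

Section Steps.
Context {R : realType}.
Implicit Types (x y : nat -> R) (s v w : R) (n p q i j : nat).

Lemma ball_avg_profile_far n m (x : 'I_n -> R) (y : 'I_m -> R) c :
  (forall a, 1 < `|c - y a|) -> ball_avg (profile x y) c = ball_avg x c.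
Proof.
move=> far; rewrite /ball_avg; congr (_^-1 * _).
  rewrite big_sumType /= [X in _ + X]big_pred0 ?addr0 // => a.
  by apply/negbTE; rewrite -ltNge far.
rewrite big_sumType /= [X in _ + X]big_pred0 ?addr0 // => a.
by apply/negbTE; rewrite -ltNge far.
Qed.

Lemma ball_avg_profile_near n (x : 'I_n -> R) s c (i : 'I_n) :
  `|c - x i| <= 1 -> `|c - s| <= 1 ->
  let N := \sum_(a | `|c - x a| <= 1) 1 in
  ball_avg (profile x (fun _ : 'I_1 => s)) c = (N * ball_avg x c + s) / (N + 1).
Proof.
move=> hi hs N.
have N1 : 1 <= N by apply: ball_size_ge1 hi.
rewrite /ball_avg big_sumType /= -/N mulrC.
have -> : \sum_(a : 'I_1 | `|c - s| <= 1) (1 : R) = 1.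
  by rewrite big_mkcond big_ord1 hs.
rewrite big_sumType /=.
have -> : \sum_(a : 'I_1 | `|c - s| <= 1) s = s.
  by rewrite big_mkcond big_ord1 hs.
by rewrite mulVKf //; lra.
Qed.

Definition free_step n x i : R := ball_avg (fun j : 'I_n => x j) (x i).

Definition guided_step n x s i : R :=
  ball_avg (profile (fun j : 'I_n => x j) (fun _ : 'I_1 => s)) (x i).

Lemma guided_step_far n x s i :
  1 < `|x i - s| -> guided_step n x s i = free_step n x i.
Proof. by move=> h; apply: ball_avg_profile_far. Qed.

Definition nondecr n x := forall i j, (i <= j)%N -> (j < n)%N -> x i <= x j.

Lemma ball_center x i : `|x i - x i| <= 1.
Proof. by rewrite subrr normr0. Qed.

Lemma free_step_nondecr n x : nondecr n x -> nondecr n (free_step n x).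
Proof.
move=> xm i j ij jn; have i_n := leq_ltn_trans ij jn.
apply: (ball_avg_mono _ _ _ (Ordinal i_n) (Ordinal jn)); first exact: xm.
all: exact: ball_center.
Qed.

Lemma guided_step_nondecr n x s : nondecr n x -> nondecr n (guided_step n x s).
Proof.
move=> xm i j ij jn; have i_n := leq_ltn_trans ij jn.
apply: (ball_avg_mono _ _ _ (inl (Ordinal i_n)) (inl (Ordinal jn))); first exact: xm.
all: exact: ball_center.
Qed.

Lemma free_step_le n x i v : (i < n)%N ->
  (forall j, (j < n)%N -> `|x i - x j| <= 1 -> x j <= v) -> free_step n x i <= v.
Proof.
move=> i_n h; apply: (ball_avg_le _ _ _ (Ordinal i_n)); last exact: ball_center.
by move=> j; apply: h.
Qed.

Lemma free_step_ge n x i v : (i < n)%N ->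
  (forall j, (j < n)%N -> `|x i - x j| <= 1 -> v <= x j) -> v <= free_step n x i.
Proof.
move=> i_n h; apply: (ball_avg_ge _ _ _ (Ordinal i_n)); last exact: ball_center.
by move=> j; apply: h.
Qed.

Lemma guided_step_le n x s i v : (i < n)%N ->
  (forall j, (j < n)%N -> `|x i - x j| <= 1 -> x j <= v) ->
  (`|x i - s| <= 1 -> s <= v) -> guided_step n x s i <= v.
Proof.
move=> i_n h hs; apply: (ball_avg_le _ _ _ (inl (Ordinal i_n))); last exact: ball_center.
by case=> [j|j] //=; apply: h.
Qed.

Lemma guided_step_ge n x s i v : (i < n)%N ->
  (forall j, (j < n)%N -> `|x i - x j| <= 1 -> v <= x j) ->
  (`|x i - s| <= 1 -> v <= s) -> v <= guided_step n x s i.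
Proof.
move=> i_n h hs; apply: (ball_avg_ge _ _ _ (inl (Ordinal i_n))); last exact: ball_center.
by case=> [j|j] //=; apply: h.
Qed.

Definition within n x v w := forall j, (j < n)%N -> v <= x j <= w.

Lemma free_step_within n x v w : within n x v w -> within n (free_step n x) v w.
Proof.
move=> h j jn; rewrite free_step_le ?free_step_ge // => i /h /andP[] //.
Qed.

Lemma guided_step_within n x s v w : v <= s <= w ->
  within n x v w -> within n (guided_step n x s) v w.
Proof.
move=> /andP[vs sw] h j jn.
by rewrite guided_step_le ?guided_step_ge // => i /h /andP[].
Qed.

Definition sep n x p v w :=
  (forall i, (i < p)%N -> x i <= v) /\
  (forall j, (p <= j)%N -> (j < n)%N -> w <= x j).

(** Nobody sees across the gap from [v] to [w], and a strategic agent to the right of the gap is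
    seen only from its right side. *)
Lemma guided_step_sep n x s p v w : (p <= n)%N -> v + 1 < w -> w <= s ->
  sep n x p v w -> sep n (guided_step n x s) p v w.
Proof.
move=> pn vw ws [hv hw]; split=> [i ip|i pi i_n].
  have i_n := leq_trans ip pn; have xi := hv _ ip.
  apply: guided_step_le => // [j jn|]; rewrite ler_norml => /andP[h1 h2]; last by lra.
  by case: (ltnP j p) => [/hv //|pj]; have := hw _ pj jn; lra.
have xi := hw _ pi i_n.
apply: guided_step_ge => // j jn; rewrite ler_norml => /andP[h1 h2].
by case: (ltnP j p) => [/hv ?|pj]; [lra|apply: hw].
Qed.

Lemma free_step_sep n x p v w : (p <= n)%N -> v + 1 < w ->
  sep n x p v w -> sep n (free_step n x) p v w.
Proof.
move=> pn vw [hv hw]; split=> [i ip|i pi i_n].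
  have i_n := leq_trans ip pn; have xi := hv _ ip.
  apply: free_step_le => // j jn; rewrite ler_norml => /andP[h1 h2].
  by case: (ltnP j p) => [/hv //|pj]; have := hw _ pj jn; lra.
have xi := hw _ pi i_n.
apply: free_step_ge => // j jn; rewrite ler_norml => /andP[h1 h2].
by case: (ltnP j p) => [/hv ?|pj]; [lra|apply: hw].
Qed.

Definition cut n x p :=
  forall i j, (i < p)%N -> (p <= j)%N -> (j < n)%N -> x i + 1 < x j.

Lemma sep_cut n x p v w : v + 1 < w -> sep n x p v w -> cut n x p.
Proof. by move=> vw [hv hw] i j /hv xi pj /(hw _ pj) xj; lra. Qed.

(** In a sorted profile a cut at [p] is a separation whose thresholds are the two values adjacent to
    the gap. *)
Lemma free_step_cut n x p : nondecr n x -> cut n x p -> cut n (free_step n x) p.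
Proof.
move=> xm xc i j ip pj jn.
case: p => [//|p] in xc ip pj *.
have pn : (p.+1 <= n)%N by exact: leq_trans pj (ltnW jn).
have vw : x p + 1 < x p.+1 by apply: xc => //; exact: leq_ltn_trans pj jn.
have sx : sep n x p.+1 (x p) (x p.+1).
  by split=> [i' ?|j' ? ?]; apply: xm.
by have := sep_cut _ _ _ _ _ vw (free_step_sep _ _ _ _ _ pn vw sx); apply.
Qed.

End Steps.

(** * Isolated blocks: stationarity, merging and progress of the minimum *)

Section Blocks.
Context {R : realType}.
Implicit Types (x y : nat -> R) (n a b i j p t M N : nat).

Definition converged_on x a b :=
  forall i j, (a <= i < b)%N -> (a <= j < b)%N -> x i = x j \/ 1 < `|x i - x j|.

Definition narrow x a b :=
  forall i j, (a <= i < b)%N -> (a <= j < b)%N -> `|x i - x j| <= 1.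

Lemma sum1_interval n a b : (b <= n)%N ->
  \sum_(j < n | (a <= j < b)%N) (1 : R) = (b - a)%:R.
Proof.
move=> bn; rewrite -(big_ord_widen_cond _ (fun j => a <= j)%N (fun=> 1)) //.
by rewrite -(big_geq_mkord _ _ xpredT (fun=> 1)) sumr_const_nat.
Qed.

Lemma sum1_sub (T : finType) (P Q : pred T) : (forall c : T, P c -> Q c) ->
  \sum_(c | P c) (1 : R) <= \sum_(c | Q c) 1.
Proof.
move=> PQ; have E c : P c = Q c && P c.
  by case: (boolP (P c)) => [/PQ ->|_]; rewrite ?andbF.
by rewrite [leRHS](bigID P) /= (eq_bigl _ _ E) lerDl sumr_ge0.
Qed.

Lemma block_ball {n x a b i j} : cut n x a -> cut n x b ->
  (a <= i < b)%N -> (i < n)%N -> (j < n)%N -> `|x i - x j| <= 1 -> (a <= j < b)%N.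
Proof.
move=> ca cb /andP[ai ib] i_n jn; rewrite ler_norml => /andP[h1 h2].
apply/andP; split; rewrite leqNgt; apply/negP => h.
  by have := ca j i h ai i_n; lra.
by have := cb i j ib h jn; lra.
Qed.

Lemma converged_on_fixed {n x a b i} : (b <= n)%N -> cut n x a -> cut n x b ->
  converged_on x a b -> (a <= i < b)%N -> free_step n x i = x i.
Proof.
move=> bn ca cb xc iab; have i_n : (i < n)%N by lia.
have E j : (j < n)%N -> `|x i - x j| <= 1 -> x j = x i.
  move=> jn h; have jab := block_ball ca cb iab i_n jn h.
  by case: (xc i j iab jab) => [->//|]; lra.
by apply/le_anti; rewrite free_step_le ?free_step_ge // => j jn /(E _ jn) ->.
Qed.

Lemma free_step_converged_on {n x a b} : (b <= n)%N -> cut n x a -> cut n x b ->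
  converged_on x a b -> converged_on (free_step n x) a b.
Proof.
move=> bn ca cb xc i j iab jab.
by rewrite !(converged_on_fixed bn ca cb xc) //; apply: xc.
Qed.

(** Every agent of the block has exactly the block as its ball, so all of them move to the same
    average. *)
Lemma narrow_merge {n x a b} : (b <= n)%N -> cut n x a -> cut n x b ->
  narrow x a b -> converged_on (free_step n x) a b.
Proof.
move=> bn ca cb xd i j iab jab; left.
have i_n : (i < n)%N by lia.
have jn : (j < n)%N by lia.
have E (l : 'I_n) k : (a <= k < b)%N -> (`|x k - x l| <= 1) = (a <= l < b)%N.
  move=> kab; apply/idP/idP => [h|lab]; last exact: xd.
  by apply: (block_ball ca cb kab _ (ltn_ord l) h); lia.
by apply: eq_ball_avg => // l; rewrite !E.
Qed.

Lemma free_step_block_min {n x a b} : (a < b <= n)%N -> nondecr n x ->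
  cut n x a -> cut n x b -> x a <= free_step n x a.
Proof.
move=> abn xm ca cb; apply: free_step_ge => [|j jn h]; first by lia.
have /andP[aj _] : (a <= j < b)%N by apply: (block_ball ca cb _ _ jn h); lia.
exact: xm.
Qed.

Lemma block_ball_size {n x a b i M} : (b <= n)%N -> (b - a <= M)%N ->
  cut n x a -> cut n x b -> (a <= i < b)%N ->
  \sum_(j < n | `|x i - x j| <= 1) (1 : R) <= M%:R.
Proof.
move=> bn bM ca cb iab; apply: (@le_trans _ _ (b - a)%:R); last by rewrite ler_nat.
rewrite -(sum1_interval n) //; apply: sum1_sub => j.
by apply: (block_ball ca cb iab) => //; lia.
Qed.

(* If the minimum x a of an isolated block moves by less than 1/(2M^2) in one step,
   all its neighbours are within 1/(2M) of it.  Unless the ball of a splits off, one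
   of these neighbours i sees an agent beyond x a + 1, so i moves to at least
   x a + 1/M while remaining in the ball of a, and then drags a along. *)
Lemma block_progress {n x a b M} : (a < b <= n)%N -> (b - a <= M)%N ->
  nondecr n x -> cut n x a -> cut n x b ->
  (exists c, [/\ (a < c <= b)%N, cut n x c & narrow x a c]) \/
  x a + (2 * M%:R ^+ 2)^-1 <= free_step n (free_step n x) a.
Proof.
move=> abn bM xm ca cb; set y := free_step n x.
have ym : nondecr n y by apply: free_step_nondecr.
have ya : cut n y a by apply: free_step_cut.
have yb : cut n y b by apply: free_step_cut.
have bn : (b <= n)%N by lia.
have a_n : (a < n)%N by lia.
have aab : (a <= a < b)%N by lia.
have xya : x a <= y a by apply: free_step_block_min xm ca cb.
have yza : y a <= free_step n y a by apply: free_step_block_min ym ya yb.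
set m : R := M%:R.
have m1 : 1 <= m by rewrite /m ler1n; lia.
set e := (2 * m ^+ 2)^-1.
have em2 : e * (2 * m ^+ 2) = 1 by rewrite mulVf //; nra.
have e0 : 0 < e by rewrite invr_gt0; nra.
case: (lerP (x a + e) (y a)) => [h|small]; first by right; lra.
have close j : (j < n)%N -> `|x a - x j| <= 1 -> (x j - x a) * (2 * m) <= 1.
  move=> jn hj.
  have : x a + (x j - x a) / m <= y a.
    apply: (ball_avg_ge_weighted _ _ _ _ (Ordinal jn)) => //.
      by move=> l /(block_ball ca cb aab a_n (ltn_ord l)) /andP[al _]; apply: xm.
    exact: (block_ball_size bn bM ca cb aab).
  have : (x j - x a) / m * m = x j - x a by rewrite divfK //; lra.
  set d := _ / m => dE hd; have : d <= e by lra.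
  by rewrite -dE => de; nra.
(* The least such [c] is the first index beyond the ball of [a], or [b] if this ball covers the
   block. *)
have exc : exists c, (a < c)%N && ((b <= c)%N || (x a + 1 < x c)).
  by exists b; rewrite leqnn; lia.
case: (ex_minnP exc) => c /andP[ac hc] cmin.
have cb' : (c <= b)%N by apply: cmin; rewrite leqnn; lia.
have near i : (a <= i < c)%N -> x a <= x i <= x a + 1.
  move=> /andP[ai ic]; rewrite xm //=; last by lia.
  move: ai; rewrite leq_eqVlt => /predU1P[<-|ai]; first by lra.
  rewrite leNgt; apply/negP => h.
  by have := cmin i; rewrite ai h orbT => /(_ isT); lia.
have nc : narrow x a c.
  by move=> i j /near /andP[? ?] /near /andP[? ?]; rewrite ler_norml; lra.
have [cc|ncc] := pselect (cut n x c); first by left; exists c; rewrite ac cb'.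
have [i [j [ic cj jn xij]]] : exists i j, [/\ (i < c)%N, (c <= j)%N, (j < n)%N & x j <= x i + 1].
  apply: contrapT => nex; apply: ncc => i j ic cj jn.
  by rewrite ltNge; apply/negP => h; apply: nex; exists i, j.
have ai : (a <= i)%N.
  rewrite leqNgt; apply/negP => h; have aj : (a <= j)%N by lia.
  by have := ca i j h aj jn; lra.
have xc : x a + 1 < x c.
  case/orP: hc => // bc; have ib : (i < b)%N by lia.
  have bj : (b <= j)%N by lia.
  by have := cb i j ib bj jn; lra.
have xj : x a + 1 < x j by apply: lt_le_trans xc (xm _ _ cj jn).
have iab : (a <= i < b)%N by lia.
have i_n : (i < n)%N by lia.
have /andP[xi1 xi2] : x a <= x i <= x a + 1 by apply: near; lia.
have xi3 : (x i - x a) * (2 * m) <= 1 by apply: close => //; rewrite ler_norml; lra.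
have yi : x a + (x j - x a) / m <= y i.
  apply: (ball_avg_ge_weighted _ _ _ _ (Ordinal jn)) => /=.
  - by move=> l /(block_ball ca cb iab i_n (ltn_ord l)) /andP[al _]; apply: xm.
  - by rewrite ler_norml; lra.
  - exact: (block_ball_size bn bM ca cb iab).
(* The ball of [i] contains [a], which holds the average about [1/m] below the maximum [x i + 1];
   this is why [i] is still in the ball of [a] after the step. *)
have yi' : y i <= (x i + 1) - (x i + 1 - x a) / m.
  apply: (ball_avg_le_weighted _ _ _ _ (Ordinal a_n)) => /=.
  - by move=> l; rewrite ler_norml => /andP[]; lra.
  - by rewrite ler_norml; lra.
  - exact: (block_ball_size bn bM ca cb iab).
have Vm : m^-1 * m = 1 by rewrite mulVf //; lra.
have V0 : 0 < m^-1 by rewrite invr_gt0; lra.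
have V1 : m^-1 <= 1 by nra.
have eV : e * 2 = m^-1 * m^-1 by rewrite /e invfM -expr2 exprVn mulrAC mulVf ?mul1r//; lra.
set V := m^-1 in yi yi' Vm V0 V1 eV *.
have xi4 : (x i - x a) * 2 <= V by nra.
have yia : x a + V <= y i by nra.
have eVV : e <= V / 2 by nra.
right; have : y a + (y i - y a) / m <= free_step n y a.
  apply: (ball_avg_ge_weighted _ _ _ _ (Ordinal i_n)) => /=.
  - by move=> l /(block_ball ya yb aab a_n (ltn_ord l)) /andP[al _]; apply: ym.
  - by rewrite ler_norml; apply/andP; split; [nra|lra].
  - exact: (block_ball_size bn bM ya yb aab).
by rewrite -/V => h; nra.
Qed.

End Blocks.

(** * Cubic convergence time of an isolated block *)

Section BlockConvergence.
Context {R : realType}.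
Implicit Types (x y : nat -> R) (n a b c d i j p t M N : nat).

Lemma converged_on_cat {n x a b c} : (c <= n)%N -> cut n x b ->
  converged_on x a b -> converged_on x b c -> converged_on x a c.
Proof.
move=> cn cb ab bc i j /andP[ai ic] /andP[aj jc].
have i_n : (i < n)%N by lia.
have jn : (j < n)%N by lia.
case: (ltnP i b) (ltnP j b) => ib [] jb.
- by apply: ab; rewrite ?ai ?aj.
- by right; have := cb i j ib jb jn; rewrite ltr_normr; lra.
- by right; have := cb j i jb ib i_n; rewrite ltr_normr; lra.
- by apply: bc; rewrite ?ib ?jb.
Qed.

Lemma iter_free_step_nondecr n x t :
  nondecr n x -> nondecr n (iter t (free_step n) x).
Proof. by move=> xm; elim: t => //= t; apply: free_step_nondecr. Qed.

Lemma iter_free_step_cut n x p t :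
  nondecr n x -> cut n x p -> cut n (iter t (free_step n) x) p.
Proof.
move=> xm xc; elim: t => //= t; apply: free_step_cut.
exact: iter_free_step_nondecr.
Qed.

Lemma free_step_block_max {n x a b} : (a < b <= n)%N -> nondecr n x ->
  cut n x a -> cut n x b -> free_step n x b.-1 <= x b.-1.
Proof.
move=> abn xm ca cb; apply: free_step_le => [|j jn h]; first by lia.
have /andP[_ jb] : (a <= j < b)%N by apply: (block_ball ca cb _ _ jn h); lia.
by apply: xm; lia.
Qed.

(** By [block_progress], each double step either finishes at least one more agent, which happens at
    most [M] times, or lifts the leftmost unfinished agent by [1/(2 M^2)], which the diameter [D]
    allows at most [2 M^2 D] times. *)
Lemma block_converges {n x a b M N} (D : R) : (a <= b <= n)%N -> (b - a <= M)%N ->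
  nondecr n x -> cut n x a -> cut n x b -> ((a < b)%N -> x b.-1 - x a <= D) ->
  M%:R + 2 * M%:R ^+ 2 * D < N%:R ->
  converged_on (iter N.*2 (free_step n) x) a b.
Proof.
move=> abn bM xm ca cb xD hN.
case: (posnP M) => [M0|M0].
  by move=> i j; lia.
have bn : (b <= n)%N by lia.
pose y t := iter t.*2 (free_step n) x.
have yS t : y t.+1 = free_step n (free_step n (y t)) by [].
have ym t : nondecr n (y t) by apply: iter_free_step_nondecr.
have ya t : cut n (y t) a by apply: iter_free_step_cut.
have yb t : cut n (y t) b by apply: iter_free_step_cut.
pose e : R := (2 * M%:R ^+ 2)^-1.
have m1 : 1 <= M%:R :> R by rewrite ler1n.
have e0 : 0 < e by rewrite invr_gt0; nra.
(* Invariant: the agents before [c] are finished. As every double step of the first kind raises [c]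
   by at least 1, [N - (c - a)] is a lower bound for the number of lifts by [e]. *)
have [c [acb _ yc hc]] : exists c, [/\ (a <= c <= b)%N, cut n (y N) c,
   converged_on (y N) a c & c = b \/ x a + (N%:R - (c - a)%:R) * e <= y N c].
  elim: N {hN} => [|t [c [acb cc yc hc]]].
    exists a; split=> //; first by rewrite leqnn; lia.
      by move=> i j; lia.
    by right; rewrite subnn subrr mul0r addr0.
  have cn : (c <= n)%N by lia.
  have fm : nondecr n (free_step n (y t)) by apply: free_step_nondecr.
  have fa : cut n (free_step n (y t)) a by apply: free_step_cut.
  have fb : cut n (free_step n (y t)) b by apply: free_step_cut.
  have fc : cut n (free_step n (y t)) c by apply: free_step_cut.
  have yc' : converged_on (y t.+1) a c.
    by rewrite yS; do 2 (apply: free_step_converged_on => //).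
  have cc' : cut n (y t.+1) c by rewrite yS; apply: free_step_cut.
  case: hc => [cb'|hc]; first by exists c; split=> //; left.
  have [cb'|cb'] := eqVneq c b; first by exists c; split=> //; left.
  have cbn : (c < b <= n)%N by lia.
  have cbM : (b - c <= M)%N by lia.
  have [[d [cdb cd nd]]|prog] := block_progress cbn cbM (ym t) cc (yb t).
    have dn : (d <= n)%N by lia.
    have fd : cut n (free_step n (y t)) d by apply: free_step_cut.
    exists d; split; first by lia.
    - by rewrite yS; apply: free_step_cut.
    - apply: (converged_on_cat dn cc' yc'); rewrite yS.
      by apply: free_step_converged_on => //; apply: narrow_merge.
    have [->|db] := eqVneq d b; [by left | right].
    apply: (@le_trans _ _ (y t c)); last first.
      apply: (@le_trans _ _ (y t.+1 c)); last by apply: ym; lia.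
      rewrite yS; apply: (le_trans (free_step_block_min cbn (ym t) cc (yb t))).
      exact: free_step_block_min cbn fm fc fb.
    apply: le_trans hc; rewrite lerD2l; apply: ler_wpM2r; first exact: ltW.
    have : (t.+1 + (c - a) <= t + (d - a))%N by lia.
    by rewrite -(ler_nat R) !natrD; lra.
  exists c; split=> //; right; rewrite yS; apply: le_trans prog.
  by rewrite -/e -natr1; nra.
case: hc => [cb'|hc]; first by rewrite cb' in yc.
have [cb'|cb'] := eqVneq c b; first by rewrite cb' in yc.
have ab : (a < b)%N by lia.
have abn' : (a < b <= n)%N by lia.
(* The maximum of the block never increases, which caps the total lift. *)
have ub : y N b.-1 <= x b.-1.
  have : forall t, iter t (free_step n) x b.-1 <= x b.-1; last by apply.
  elim=> //= t; apply: le_trans; apply: (free_step_block_max abn').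
  - exact: iter_free_step_nondecr.
  - exact: iter_free_step_cut.
  - exact: iter_free_step_cut.
have ycb : y N c <= y N b.-1 by apply: ym; lia.
have xab := xD ab.
have caM : (c - a)%:R <= M%:R :> R by rewrite ler_nat; lia.
have eM : e * (2 * M%:R ^+ 2) = 1 by rewrite mulVf //; nra.
have : (N%:R - (c - a)%:R) * e <= D by lra.
move=> h; exfalso.
have : (N%:R - (c - a)%:R) * e * (2 * M%:R ^+ 2) <= D * (2 * M%:R ^+ 2).
  by apply: ler_wpM2r => //; nra.
by rewrite -mulrA eM mulr1; nra.
Qed.

Lemma iter_free_step_converged_on {n x a b t} : (b <= n)%N -> nondecr n x ->
  cut n x a -> cut n x b -> converged_on x a b ->
  converged_on (iter t (free_step n) x) a b.
Proof.
move=> bn xm ca cb xc; elim: t => //= t; apply: free_step_converged_on => //.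
  exact: iter_free_step_cut.
exact: iter_free_step_cut.
Qed.

End BlockConvergence.

(** * Balls of sorted profiles are index intervals; reflection symmetry of a step *)

Section Intervals.
Context {R : realType}.
Implicit Types (x : nat -> R) (n i j lo hi : nat).

Lemma ball_interval {n x i lo hi} : nondecr n x -> (lo <= i < hi)%N -> (hi <= n)%N ->
  x i - x lo <= 1 -> x hi.-1 - x i <= 1 ->
  ((0 < lo)%N -> 1 < x i - x lo.-1) -> ((hi < n)%N -> 1 < x hi - x i) ->
  forall j, (j < n)%N -> (`|x i - x j| <= 1) = (lo <= j < hi)%N.
Proof.
move=> xm lih hn xl xh xl' xh' j jn; rewrite ler_norml.
apply/andP/idP => [[h1 h2]|/andP[lj jh]]; last first.
  have : x lo <= x j by apply: xm.
  have : x j <= x hi.-1 by apply: xm; lia.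
  by split; lra.
apply/andP; split; rewrite leqNgt; apply/negP => h.
  have lo0 : (0 < lo)%N by lia.
  have : x j <= x lo.-1 by apply: xm; lia.
  by have := xl' lo0; lra.
have hin : (hi < n)%N by lia.
have : x hi <= x j by apply: xm; lia.
by have := xh' hin; lra.
Qed.

Lemma sum_interval n lo hi (F : nat -> R) : (hi <= n)%N ->
  \sum_(j < n | (lo <= j < hi)%N) F j = \sum_(lo <= j < hi) F j.
Proof.
move=> hn; rewrite -(big_ord_widen_cond _ (fun j => lo <= j)%N F) //.
by rewrite -(big_geq_mkord _ _ xpredT F).
Qed.

Lemma free_step_interval {n x i lo hi} : (hi <= n)%N ->
  (forall j, (j < n)%N -> (`|x i - x j| <= 1) = (lo <= j < hi)%N) ->
  free_step n x i = (hi - lo)%:R^-1 * \sum_(lo <= j < hi) x j.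
Proof.
move=> hn E; rewrite /free_step /ball_avg.
have E' (j : 'I_n) : (`|x i - x j| <= 1) = (lo <= j < hi)%N by apply: E.
by rewrite !(eq_bigl _ _ E') sum1_interval // sum_interval.
Qed.

(** The map [x |-> c - x] together with reversal of the indices carries balls to balls, hence
    averages to averages. *)
Lemma free_step_reflect n x (c : R) : (forall j, (j < n)%N -> x j + x (n.-1 - j)%N = c) ->
  forall j, (j < n)%N -> free_step n x j + free_step n x (n.-1 - j)%N = c.
Proof.
move=> xs j jn; have jn' : (n.-1 - j < n)%N by lia.
have rE (l : 'I_n) : x (rev_ord l) = c - x l.
  have -> : rev_ord l = (n.-1 - l)%N :> nat by rewrite /=; lia.
  by rewrite -(xs l (ltn_ord l)); lra.
have xj : x (n.-1 - j)%N = c - x j by rewrite -(xs j jn); lra.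
have E (l : 'I_n) : (`|c - x j - x (rev_ord l)| <= 1) = (`|x j - x l| <= 1).
  rewrite rE; have -> : c - x j - (c - x l) = - (x j - x l) by lra.
  by rewrite normrN.
have -> : free_step n x (n.-1 - j)%N = (\sum_(l < n | `|x j - x l| <= 1) 1)^-1 *
    \sum_(l < n | `|x j - x l| <= 1) (c - x l).
  rewrite /free_step xj /ball_avg; congr (_^-1 * _).
    by rewrite (reindex_inj rev_ord_inj); apply: eq_bigl.
  rewrite (reindex_inj rev_ord_inj); by apply: eq_big => [l|l _]; [exact: E|exact: rE].
have := ball_avg_sub (fun l : 'I_n => x l) (x j) c (Ordinal jn) (ball_center _ _).
rewrite -/(free_step n x j) => /(canRL (subrK c)) ->.
rewrite [LHS]addrAC -mulrDr -big_split /=.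
by rewrite [X in _ * X]big1 ?mulr0 ?add0r // => l _; lra.
Qed.

End Intervals.

(** * An explicit supersolution of the discrete heat equation *)

Section Barrier.
Context {R : realType}.
Implicit Types (K T r : R).

Definition pos_sqr r : R := Num.max 0 r ^+ 2.

Lemma pos_sqr_ge0 r : 0 <= pos_sqr r.
Proof. exact: sqr_ge0. Qed.

Lemma pos_sqr_pos r : 0 <= r -> pos_sqr r = r ^+ 2.
Proof. by move=> r0; rewrite /pos_sqr max_r. Qed.

Lemma pos_sqr_neg r : r <= 0 -> pos_sqr r = 0.
Proof. by move=> r0; rewrite /pos_sqr max_l // expr0n. Qed.

Lemma pos_sqr_mono r s : r <= s -> pos_sqr r <= pos_sqr s.
Proof.
move=> rs; case: (lerP 0 r) => r0; first by rewrite !pos_sqr_pos; nra.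
by rewrite (pos_sqr_neg r) ?pos_sqr_ge0 // ltW.
Qed.

Lemma pos_sqr_second_difference r :
  pos_sqr (r + 1) + pos_sqr (r - 1) <= 2 * pos_sqr r + 2.
Proof.
case: (lerP 0 r) => r0.
  rewrite (pos_sqr_pos (r + 1)) ?(pos_sqr_pos r) //; last by lra.
  by case: (lerP 1 r) => r1; [rewrite pos_sqr_pos|rewrite pos_sqr_neg]; nra.
rewrite (pos_sqr_neg (r - 1)) ?(pos_sqr_neg r); [|lra..].
by case: (lerP (-1) r) => r1; [rewrite pos_sqr_pos|rewrite pos_sqr_neg]; nra.
Qed.

(* Supersolution of the heat equation w' r = (w (r - 1) + w r + w (r + 1)) / 3 on
   [0, K - 1], T being the time, with an influx 3/K^2 per step at both ends. *)
Definition barrier K T r : R :=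
  45 / K ^+ 3 * (pos_sqr (K / 10 - r) + pos_sqr (r + 1 - K + K / 10) + 4 / 3 * T).

Lemma barrier_sym K T r : barrier K T (K - 1 - r) = barrier K T r.
Proof.
rewrite /barrier; congr (_ * (_ + _)); rewrite addrC.
by congr (pos_sqr _ + pos_sqr _); lra.
Qed.

Lemma barrier_ge0 K T r : 0 < K -> 0 <= T -> 0 <= barrier K T r.
Proof.
move=> K0 T0; rewrite mulr_ge0 ?divr_ge0 ?exprn_ge0 ?(ltW K0) //.
by rewrite !addr_ge0 ?pos_sqr_ge0 //; lra.
Qed.

(** Averaging over three neighbours raises each of the two squared positive parts by at most [2/3];
    the time term grows by [4/3] per step and absorbs both. *)
Lemma barrier_interior K T r : 0 < K ->
  (barrier K T (r - 1) + barrier K T r + barrier K T (r + 1)) / 3 <= barrier K (T + 1) r.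
Proof.
move=> K0; rewrite /barrier; set c := 45 / K ^+ 3.
have c0 : 0 < c by rewrite divr_gt0 ?exprn_gt0.
have := pos_sqr_second_difference (K / 10 - r).
have := pos_sqr_second_difference (r + 1 - K + K / 10).
have -> : K / 10 - (r - 1) = K / 10 - r + 1 by lra.
have -> : K / 10 - (r + 1) = K / 10 - r - 1 by lra.
have -> : r - 1 + 1 - K + K / 10 = r + 1 - K + K / 10 - 1 by lra.
have -> : r + 1 + 1 - K + K / 10 = r + 1 - K + K / 10 + 1 by lra.
by move: (pos_sqr _) (pos_sqr _) (pos_sqr _) (pos_sqr _) (pos_sqr _) (pos_sqr _);
  move=> u1 u2 u3 u4 u5 u6; nra.
Qed.

(** The missing left neighbour is replaced by the end itself. From 0 to 1 the parabola drops by
    [K/5 - 1]; a third of [K/5] is [K/15], which is the influx in units of [45/K^3]. This fixes the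
    factor 45. *)
Lemma barrier_edge K T : 300 <= K ->
  3 / K ^+ 2 + (2 * barrier K T 0 + barrier K T 1) / 3 <= barrier K (T + 1) 0.
Proof.
move=> K0; rewrite /barrier; set c := 45 / K ^+ 3.
have K2 : K^-1 * K = 1 by rewrite mulVf //; lra.
have -> : 3 / K ^+ 2 = c * (K / 15).
  by rewrite /c; field; lra.
have c0 : 0 < c by rewrite divr_gt0 ?exprn_gt0 //; lra.
rewrite (pos_sqr_neg (0 + 1 - K + K / 10)) ?(pos_sqr_neg (1 + 1 - K + K / 10)); [|lra..].
rewrite (pos_sqr_pos (K / 10 - 0)) ?(pos_sqr_pos (K / 10 - 1)); [|lra..].
by nra.
Qed.

(** The parabola contributes [45/100] and the elapsed time at most [1/5]. The sum stays below
    [(K - 1)/(K + 2)], the lower bound for [K] times the distance of the first cluster from the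
    chain. *)
Lemma barrier0_le K T : 300 <= K -> 300 * T <= K ^+ 2 -> barrier K T 0 * K <= 65 / 100.
Proof.
move=> K0 hT; rewrite /barrier.
rewrite (pos_sqr_neg (0 + 1 - K + K / 10)) ?(pos_sqr_pos (K / 10 - 0)); [|lra..].
have -> : 45 / K ^+ 3 * ((K / 10 - 0) ^+ 2 + 0 + 4 / 3 * T) * K
  = 45 / 100 + 60 * T / K ^+ 2 by field; lra.
have : 60 * T / K ^+ 2 <= 1 / 5 by rewrite ler_pdivrMr ?exprn_gt0; lra.
by lra.
Qed.

Lemma barrier_le K T r : 300 <= K -> 300 * T <= K ^+ 2 -> 0 <= r <= K - 1 ->
  barrier K T r <= 1 / 100.
Proof.
move=> K0 hT /andP[r0 r1].
have h1 : pos_sqr (K / 10 - r) <= (K / 10) ^+ 2.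
  by rewrite -pos_sqr_pos; [apply: pos_sqr_mono|]; lra.
have h2 : pos_sqr (r + 1 - K + K / 10) <= (K / 10) ^+ 2.
  by rewrite -pos_sqr_pos; [apply: pos_sqr_mono|]; lra.
have c0 : 0 < 45 / K ^+ 3 by rewrite divr_gt0 ?exprn_gt0 //; lra.
apply: (@le_trans _ _ (45 / K ^+ 3 * (2 * (K / 10) ^+ 2 + 4 / 3 * T))).
  by rewrite /barrier; apply: ler_wpM2l; [exact: ltW|lra].
apply: (@le_trans _ _ (45 / K ^+ 3 * (K ^+ 2 / 40))).
  by apply: ler_wpM2l; [exact: ltW|nra].
have -> : 45 / K ^+ 3 * (K ^+ 2 / 40) = 9 / 8 / K by field; lra.
by rewrite ler_pdivrMr; lra.
Qed.

End Barrier.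

(** * Geometry and one step of the metastable dumbbell *)

Section Dumbbell.
Context {R : realType}.
Implicit Types (x : nat -> R) (i j k t : nat).

Definition dumbbell_pos k j : R :=
  if (j < k)%N then - k%:R^-1
  else if (j <= 2 * k)%N then (j - k)%N%:R
  else k%:R + k%:R^-1.

(* The dumbbell while its communication graph is the initial one: the chain gaps
   are at most 1 and shrink from the ends, while the first cluster stays at
   distance about 1/k from the first chain agent. *)
Record metastable k t x : Prop := Metastable {
  ms_nondecr : nondecr (3 * k + 1) x;
  ms_sym : forall j, (j < 3 * k + 1)%N -> x j + x (3 * k - j)%N = k%:R;
  ms_cluster : forall j, (j < k)%N -> x j = x 0%N;
  ms_head_lo : k%:R - 1 <= (x k - x 0%N) * (k%:R * (k%:R + 2));
  ms_head_hi : (x k - x 0%N) * k%:R <= 1;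
  ms_gap : forall i, (i < k)%N ->
    0 <= 1 - (x (k + i).+1 - x (k + i)%N) <= barrier k%:R t%:R i%:R;
  ms_cluster_lo : -1 <= x 0%N * k%:R;
  ms_cluster_hi : (x 0%N * k%:R + 1) * k%:R <= t%:R }.

Section Fixed.
Context {k t : nat} {x : nat -> R}.
Hypotheses (k300 : (300 <= k)%N) (tk : (300 * t <= k ^ 2)%N) (ms : metastable k t x).
Local Notation n := (3 * k + 1)%N.

Let K300 : 300 <= k%:R :> R.
Proof. by rewrite (ler_nat _ 300). Qed.

Let TK : 300 * t%:R <= k%:R ^+ 2 :> R.
Proof. by rewrite -natrX -natrM ler_nat. Qed.

Lemma ms_gap_small i : (i < k)%N ->
  99 / 100 <= x (k + i).+1 - x (k + i)%N <= 1.
Proof.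
move=> ik; have /andP[h1 h2] := ms_gap _ _ _ ms i ik.
have : barrier k%:R t%:R i%:R <= 1 / 100 :> R.
  apply: barrier_le => //; rewrite ler0n /= lerBrDr natr1 ler_nat //.
by lra.
Qed.

Lemma ms_head : 0 <= x k - x 0%N <= 1 / 100.
Proof.
have K3 := K300; have T3 := TK.
have h1 := ms_head_lo _ _ _ ms; have h2 := ms_head_hi _ _ _ ms.
set a := x k - x 0%N in h1 h2 *.
have a0 : 0 <= a.
  by rewrite -(pmulr_lge0 a (_ : 0 < k%:R * (k%:R + 2))); [lra|rewrite mulr_gt0; lra].
by apply/andP; split; nra.
Qed.

(** This amounts to [e < a] for the deficit [e] of the first chain gap and the distance [a] of the
    cluster from the chain: [e k <= 65/100] by the barrier, but [a k >= 98/100]. *)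
Lemma ms_cluster_gap : 1 < x k.+1 - x 0%N.
Proof.
have K3 := K300; have T3 := TK.
have k0 : (0 < k)%N by lia.
have /andP[h1 h2] := ms_gap _ _ _ ms 0%N k0.
have h3 := barrier0_le _ _ K300 TK.
have h4 := ms_head_lo _ _ _ ms; have h5 := ms_head_hi _ _ _ ms.
rewrite addn0 in h1 h2.
set e := 1 - _ in h1 h2; set w := barrier _ _ _ in h2 h3.
have ew : e * k%:R <= 65 / 100 by nra.
set a := x k - x 0%N in h4 h5.
suff : e < a by rewrite /e /a; lra.
have : 98 / 100 <= a * k%:R by nra.
by nra.
Qed.

(** Gaps of at most 1 make the chain at most [k] long, so by symmetry it starts at 0 or to the right
    of it. The upper bound comes from the drift of the cluster, at most [1/k^2] per step. *)
Lemma ms_head_abs : 0 <= x k <= 1 / 100.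
Proof.
have s : x k + x (2 * k)%N = k%:R.
  have kn : (k < n)%N by lia.
  by rewrite -(ms_sym _ _ _ ms k kn); congr (x _ + x _); lia.
have c i : (i <= k)%N -> x (k + i)%N <= x k + i%:R.
  elim: i => [|i IH] ik; first by rewrite addn0 addr0.
  have := ms_gap_small i ik; have := IH (ltnW ik).
  by rewrite addnS -natr1; lra.
have := c k (leqnn k); have -> : (k + k = 2 * k)%N by lia.
have h1 := ms_head_lo _ _ _ ms; have h2 := ms_head_hi _ _ _ ms.
have h3 := ms_cluster_lo _ _ _ ms; have h4 := ms_cluster_hi _ _ _ ms.
have K3 := K300; have T3 := TK.
move=> h5; apply/andP; split; first by lra.
have : x k * k%:R * k%:R <= t%:R by nra.
by nra.
Qed.

Lemma ms_chain_pos i : (i <= k)%N ->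
  i%:R - 1 / 100 <= x (k + i)%N <= i%:R + 1 / 100.
Proof.
have c j : (j <= k)%N -> x (k + j)%N <= x k + j%:R.
  elim: j => [|j IH] jk; first by rewrite addn0 addr0.
  have := ms_gap_small j jk; have := IH (ltnW jk).
  by rewrite addnS -natr1; lra.
move=> ik; have := ms_head_abs; have := c i ik.
have := c (k - i)%N (leq_subr _ _); rewrite natrB //.
have : x (k + i)%N + x (k + (k - i))%N = k%:R.
  by rewrite -(ms_sym _ _ _ ms (k + i)%N); [congr (x _ + x _); lia|lia].
by move=> ? ? ? ?; lra.
Qed.

(** Two gaps of at least [99/100] suffice, except next to the cluster, where [ms_cluster_gap] is
    used; the right-hand inequality is the mirror image of the left-hand one. *)
Lemma ms_two_apart j : (k < j < 2 * k)%N ->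
  1 < x j - x j.-2 /\ 1 < x j.+2 - x j.
Proof.
have two_left i : (k < i <= 2 * k)%N -> 1 < x i - x i.-2.
  move=> ik; have [->|ik1] := eqVneq i k.+1.
    by rewrite /= (ms_cluster _ _ _ ms k.-1); [exact: ms_cluster_gap|lia].
  have := ms_gap_small (i - k - 2)%N; have := ms_gap_small (i - k - 1)%N.
  have -> : (k + (i - k - 1)).+1 = i by lia.
  have -> : (k + (i - k - 1) = i.-1)%N by lia.
  have -> : (k + (i - k - 2)).+1 = i.-1 by lia.
  have -> : (k + (i - k - 2) = i.-2)%N by lia.
  have -> : (i - k - 1 < k)%N by lia.
  have -> : (i - k - 2 < k)%N by lia.
  by move=> /(_ isT) ? /(_ isT) ?; lra.
move=> jk; split; first by apply: two_left; lia.
have := two_left (3 * k - j)%N; have -> : (k < 3 * k - j <= 2 * k)%N by lia.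
move=> /(_ isT).
have s1 := ms_sym _ _ _ ms j; have s2 := ms_sym _ _ _ ms j.+2.
have -> : ((3 * k - j).-2 = 3 * k - j.+2)%N by lia.
have {}s1 := s1 ltac:(lia); have {}s2 := s2 ltac:(lia).
by lra.
Qed.

(** With the next two lemmas and the symmetry, this says that the communication graph is still the
    initial one. *)
Lemma ms_ball_cluster i j : (i < k)%N -> (j < n)%N ->
  (`|x i - x j| <= 1) = (0 <= j < k.+1)%N.
Proof.
move=> ik; apply: ball_interval => //; rewrite ?(ms_cluster _ _ _ ms i) //=.
- exact: ms_nondecr ms.
- by lia.
- by lia.
- by rewrite subrr.
- by have := ms_head; lra.
- by move=> _; apply: ms_cluster_gap.
Qed.

Lemma ms_ball_head j : (j < n)%N ->
  (`|x k - x j| <= 1) = (0 <= j < k.+2)%N.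
Proof.
have k0 : (0 < k)%N by lia.
have k1 : (1 < k)%N by lia.
have kn : (k.+2 <= n)%N by lia.
have g0 := ms_gap_small 0%N k0; have g1 := ms_gap_small 1%N k1.
have h := ms_head.
rewrite addn0 in g0; rewrite addn1 in g1.
apply: ball_interval => //=.
- exact: ms_nondecr ms.
- by lra.
- by lra.
- by move=> _; lra.
Qed.

Lemma ms_ball_chain i j : (k < i < 2 * k)%N -> (j < n)%N ->
  (`|x i - x j| <= 1) = (i.-1 <= j < i.+2)%N.
Proof.
move=> ik.
have i1 : (i.-1 <= i < i.+2)%N by lia.
have i2 : (i.+2 <= n)%N by lia.
have := ms_gap_small (i - k)%N; have := ms_gap_small (i.-1 - k)%N.
have -> : (k + (i - k) = i)%N by lia.
have -> : (k + (i.-1 - k) = i.-1)%N by lia.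
have -> : i.-1.+1 = i by lia.
have -> : (i - k < k)%N by lia.
have -> : (i.-1 - k < k)%N by lia.
move=> /(_ isT) ? /(_ isT) ?.
have [h1 h2] := ms_two_apart i ik.
apply: ball_interval => //=; [exact: ms_nondecr ms|lra|lra].
Qed.

Lemma ms_step_cluster i : (i < k)%N ->
  free_step n x i = (k%:R + 1)^-1 * (k%:R * x 0%N + x k).
Proof.
move=> ik; rewrite (free_step_interval _ (fun j => ms_ball_cluster i j ik)); last by lia.
rewrite subn0 natr1 big_nat_recr //=; congr (_ * (_ + _)).
rewrite (eq_big_nat _ _ (F2 := fun=> x 0%N)); last by move=> j /andP[_ /(ms_cluster _ _ _ ms)].
by rewrite sumr_const_nat subn0 mulr_natl.
Qed.

Lemma ms_step_head :
  free_step n x k = (k%:R + 2)^-1 * (k%:R * x 0%N + x k + x k.+1).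
Proof.
rewrite (free_step_interval _ ms_ball_head); last by lia.
rewrite subn0 -(natrD _ k 2) addn2 !big_nat_recr //=; congr (_ * (_ + _ + _)).
rewrite (eq_big_nat _ _ (F2 := fun=> x 0%N)); last by move=> j /andP[_ /(ms_cluster _ _ _ ms)].
by rewrite sumr_const_nat subn0 mulr_natl.
Qed.

Lemma ms_step_chain i : (k < i < 2 * k)%N ->
  free_step n x i = (x i.-1 + x i + x i.+1) / 3.
Proof.
move=> ik; rewrite (free_step_interval _ (fun j => ms_ball_chain i j ik)); last by lia.
have -> : (i.+2 - i.-1 = 3)%N by lia.
have -> : i.+2 = i.-1.+3 by lia.
rewrite big_ltn; last by lia.
rewrite big_ltn; last by lia.
rewrite big_nat1 mulrC addrA.
by have -> : i.-1.+1 = i by lia.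
Qed.

Lemma ms_ball_chain_size i : (k < i < 2 * k)%N ->
  \sum_(j < n | `|x i - x j| <= 1) (1 : R) = 3.
Proof.
move=> ik.
have E (j : 'I_n) : (`|x i - x j| <= 1) = (i.-1 <= j < i.+2)%N.
  exact: ms_ball_chain.
rewrite (eq_bigl _ _ E) sum1_interval; last by lia.
by congr (_%:R); lia.
Qed.

End Fixed.

End Dumbbell.

(** * The metastable state persists for a quadratic number of steps *)

Section Metastability.
Context {R : realType}.
Implicit Types (x : nat -> R) (i j k t : nat).

Lemma metastable_dumbbell k : (0 < k)%N -> metastable k 0 (dumbbell_pos k : nat -> R).
Proof.
move=> k0; have K1 : 1 <= k%:R :> R by rewrite ler1n.
have V : k%:R^-1 * k%:R = 1 :> R by rewrite mulVf //; lra.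
have V0 : 0 < k%:R^-1 :> R by rewrite invr_gt0; lra.
have chainE i : (k <= i <= 2 * k)%N -> dumbbell_pos k i = (i - k)%N%:R :> R.
  by case/andP=> h1 h2; rewrite /dumbbell_pos ltnNge h1 h2.
have lE i : (i < k)%N -> dumbbell_pos k i = - k%:R^-1 :> R.
  by rewrite /dumbbell_pos => ->.
have rE i : (2 * k < i)%N -> dumbbell_pos k i = k%:R + k%:R^-1 :> R.
  move=> h; rewrite /dumbbell_pos; have -> : (i < k)%N = false by lia.
  by have -> : (i <= 2 * k)%N = false by lia.
have x0 : dumbbell_pos k 0%N = - k%:R^-1 :> R by apply: lE.
have xk : dumbbell_pos k k = 0 :> R by rewrite chainE ?subnn //; lia.
split.
- move=> i j ij _; case: (ltnP i k) => ik.
    rewrite lE //; case: (ltnP j k) => jk; first by rewrite lE.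
    case: (leqP j (2 * k)) => j2; last by rewrite rE //; lra.
    by rewrite chainE ?jk //; have := ler0n R (j - k); lra.
  case: (leqP j (2 * k)) => j2.
    by rewrite !chainE ?ler_nat; lia.
  rewrite (rE j) //; case: (leqP i (2 * k)) => i2; last by rewrite rE.
  rewrite chainE ?ik //; have : (i - k)%:R <= k%:R :> R by rewrite ler_nat; lia.
  by lra.
- move=> j jn; case: (ltnP j k) => jk.
    by rewrite lE // rE; [lra|lia].
  case: (leqP j (2 * k)) => j2.
    by rewrite !chainE -?natrD; [congr (_%:R)| |]; lia.
  by rewrite rE // lE; [lra|lia].
- by move=> j jk; rewrite x0 lE.
- by rewrite x0 xk; nra.
- by rewrite x0 xk; nra.
- move=> i ik; rewrite !chainE; [|lia..].
  have -> : ((k + i).+1 - k = i.+1)%N by lia.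
  rewrite addKn -natr1; have := barrier_ge0 k%:R 0 (i%:R : R) ltac:(lra) (lexx _).
  by move=> ?; apply/andP; split; lra.
- by rewrite x0; nra.
- by rewrite x0; nra.
Qed.

Lemma metastable_step k t x : (300 <= k)%N -> (300 * t <= k ^ 2)%N ->
  metastable k t x -> metastable k t.+1 (free_step (3 * k + 1) x).
Proof.
move=> k300 tk ms; set n := (3 * k + 1)%N; set y := free_step n x.
have K3 : 300 <= k%:R :> R by rewrite (ler_nat _ 300).
have T3 : 300 * t%:R <= k%:R ^+ 2 :> R by rewrite -natrX -natrM ler_nat.
have k0 : (0 < k)%N by lia.
have k1 : (1 < k)%N by lia.
have kc : (k < k.+1 < 2 * k)%N by lia.
have [kn k1n] : (k < n)%N /\ (k.+1 < n)%N by rewrite /n; lia.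
have [km1 km2 km3] : [/\ (k + k.-1).+1 = (2 * k)%N, (k + k.-1 = 3 * k - k.+1)%N &
    (3 * k - k = 2 * k)%N] by split; lia.
have interior i : (i < k)%N -> i != 0%N -> i != k.-1 ->
    [/\ (i.-1 < k)%N, (i.+1 < k)%N, (k < k + i < 2 * k)%N, (k < (k + i).+1 < 2 * k)%N &
     (k + i.-1).+1 = (k + i)%N] by move=> ? ? ?; split; lia.
have predE i : i != 0%N -> i%:R - 1 = i.-1%:R :> R.
  by case: i => // i _; rewrite -natr1 addrK.
have k1E : k.-1%:R = k%:R - 1 - 0 :> R by rewrite subr0 predE // -lt0n.
have ys : forall j, (j < n)%N -> y j + y (3 * k - j)%N = k%:R.
  have := free_step_reflect n x k%:R; have -> : n.-1 = (3 * k)%N by lia.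
  by apply; apply: ms_sym ms.
have yl i : (i < k)%N -> y i = (k%:R + 1)^-1 * (k%:R * x 0%N + x k).
  exact: (ms_step_cluster k300 tk ms).
have yk : y k = (k%:R + 2)^-1 * (k%:R * x 0%N + x k + x k.+1) by apply: (ms_step_head k300 tk ms).
have yc i : (k < i < 2 * k)%N -> y i = (x i.-1 + x i + x i.+1) / 3.
  exact: (ms_step_chain k300 tk ms).
have /andP[e0 e0w] := ms_gap _ _ _ ms 0%N k0.
have /andP[e1 e1w] := ms_gap _ _ _ ms 1%N k1.
have ew := barrier0_le _ _ K3 T3.
have alo := ms_head_lo _ _ _ ms; have ahi := ms_head_hi _ _ _ ms.
have /andP[a0 _] := ms_head k300 tk ms.
rewrite addn0 in e0 e0w; rewrite addn1 in e1 e1w.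
set a := x k - x 0%N in alo ahi a0.
set e := 1 - (x k.+1 - x k) in e0 e0w.
set e' := 1 - (x k.+2 - x k.+1) in e1 e1w.
have eK : e * k%:R <= 65 / 100 by nra.
have p1 : 0 < k%:R + 1 :> R by lra.
have p2 : 0 < k%:R + 2 :> R by lra.
have aE : (y k - y 0%N) * ((k%:R + 1) * (k%:R + 2)) =
    (k%:R + 1) * (2 * a - e + 1) - a * (k%:R + 2).
  by rewrite yk yl // /a /e; field; lra.
(* The heat equation at the end, plus an influx. As [k a >= (k - 1)/(k + 2)], the influx is at most
   [3/(k + 2)^2], within the rate that [barrier_edge] allows. *)
have eE : 1 - (y k.+1 - y k) = (1 - k%:R * a - e) / (k%:R + 2) + (2 * e + e') / 3.
  by rewrite yc // yk /a /e /e'; field; lra.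
have pE : y 0%N = x 0%N + a / (k%:R + 1).
  by rewrite yl // /a; field; lra.
have gap0 : 0 <= 1 - (y k.+1 - y k) <= barrier k%:R t.+1%:R 0.
  rewrite eE; apply/andP; split.
    have : - (e / 2) <= (1 - k%:R * a - e) / (k%:R + 2) by rewrite ler_pdivlMr //; nra.
    by lra.
  rewrite -[t.+1%:R]natr1; apply: le_trans (barrier_edge _ _ K3).
  have : (1 - k%:R * a - e) / (k%:R + 2) <= 3 / k%:R ^+ 2.
    rewrite ler_pdivrMr // mulrAC ler_pdivlMr ?exprn_gt0 //; last by lra.
    by nra.
  by lra.
split.
- exact: free_step_nondecr (ms_nondecr _ _ _ ms).
- exact: ys.
- by move=> j jk; rewrite !yl.
(* By [aE] the new distance [a'] satisfies [(k + 2) a' = 1 - e + a k/(k + 1)]. Here [e k < 1] and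
   [a >= 0] give the lower bound; [e >= 0] and [a k <= 1] give the upper bound of the next case. *)
- by nra.
- by nra.
- move=> i ik; have [->|i0] := eqVneq i 0%N; first by rewrite addn0.
  (* The last gap mirrors the first one. *)
  have [->|ik1] := eqVneq i k.-1.
    rewrite k1E barrier_sym km1 km2.
    by have := ys k kn; have := ys k.+1 k1n; rewrite km3 => s1 s2; lra.
  have [i1k i2k ki ki1 kiS] := interior i ik i0 ik1.
  have := ms_gap _ _ _ ms _ ik; have := ms_gap _ _ _ ms _ i1k; have := ms_gap _ _ _ ms _ i2k.
  have K0 : 0 < k%:R :> R by lra.
  have := barrier_interior k%:R t%:R i%:R K0; rewrite !natr1 predE //.
  rewrite !yc //= kiS addnS.
  have -> : (k + i).-1 = (k + i.-1)%N by rewrite -kiS.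
  by move=> ? /andP[? ?] /andP[? ?] /andP[? ?]; apply/andP; split; lra.
- rewrite pE; have : 0 <= a / (k%:R + 1) by rewrite divr_ge0 // ltW.
  by have := ms_cluster_lo _ _ _ ms; nra.
- have h := ms_cluster_hi _ _ _ ms; rewrite pE -[t.+1%:R]natr1.
  have : a / (k%:R + 1) * k%:R * k%:R <= 1.
    by rewrite -mulrA mulrAC ler_pdivrMr // mul1r; nra.
  by nra.
Qed.

Lemma metastable_iter k t : (300 <= k)%N -> (300 * t <= k ^ 2)%N ->
  metastable k t (iter t (free_step (3 * k + 1)) (dumbbell_pos k) : nat -> R).
Proof.
move=> k300; elim: t => [|t IH] tk; first by apply: metastable_dumbbell; lia.
by rewrite iterS; apply: metastable_step => //; [|apply: IH]; lia.
Qed.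

End Metastability.

(** * Orbits as iterated steps, and existence of convergence times *)

Section Trajectories.
Context {R : realType}.
Implicit Types (x : nat -> R) (n t : nat) (s : nat -> R).

Fixpoint guided_orbit n x s t : nat -> R :=
  if t is t'.+1 then guided_step n (guided_orbit n x s t') (s t') else x.

Lemma opinions_guided n x s t :
  opinions (fun i : 'I_n => x i) (fun t (_ : 'I_1) => s t) t =
  (fun i : 'I_n => guided_orbit n x s t i).
Proof.
elim: t => //= t ->; apply/funext => i.
by rewrite hk_step_ball_avg.
Qed.

Lemma opinions_free n x t :
  opinions (fun i : 'I_n => x i) no_strategic_agent t =
  (fun i : 'I_n => iter t (free_step n) x i).
Proof.
elim: t => //= t ->; apply/funext => i.
by rewrite hk_step_ball_avg ball_avg_profile_far // => -[].
Qed.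

(** Free steps preserve the interval [[v, w]], so a strategic agent beyond [w + 1] is never seen
    again. *)
Lemma guided_orbit_far n x s v w t0 r :
  within n (guided_orbit n x s t0) v w -> (forall t, (t0 <= t)%N -> w + 1 < s t) ->
  forall i, (i < n)%N ->
  guided_orbit n x s (t0 + r) i = iter r (free_step n) (guided_orbit n x s t0) i.
Proof.
move=> xw far; set y := guided_orbit n x s t0.
have yw t : within n (iter t (free_step n) y) v w.
  by elim: t => //= t; apply: free_step_within.
elim: r => [|r IH] i i_n; first by rewrite addn0.
rewrite addnS /=.
have -> : guided_step n (guided_orbit n x s (t0 + r)) (s (t0 + r)%N) i =
    guided_step n (iter r (free_step n) y) (s (t0 + r)%N) i.
  by apply: eq_ball_avg => [[a|a]|[a|a]] //=; rewrite !IH.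
apply: guided_step_far; rewrite distrC ltr_normr.
have /andP[_ h] := yw r i i_n; have := far (t0 + r)%N (leq_addr _ _).
by lra.
Qed.

Lemma converged_onP n x : converged_on x 0 n -> converged (fun i : 'I_n => x i).
Proof. by move=> xc i j; apply: xc; rewrite /= ltn_ord. Qed.

(** The whole profile is one block, its cuts at [0] and [n] being vacuous. *)
Lemma free_orbit_converges n x : nondecr n x ->
  exists t, converged_on (iter t (free_step n) x) 0 n.
Proof.
move=> xm; set r := n%:R + 2 * n%:R ^+ 2 * (x n.-1 - x 0%N).
have c0 : cut n x 0 by [].
have cn : cut n x n by move=> i j _ nj; rewrite ltnNge nj.
have h0 : (0 <= n <= n)%N by rewrite leqnn.
have hn : (n - 0 <= n)%N by rewrite subn0.
exists (Num.bound `|r|).*2.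
apply: (block_converges (x n.-1 - x 0%N) h0 hn xm c0 cn) => //.
by apply: le_lt_trans (ler_norm _) _; apply: archi_boundP; rewrite normr_ge0.
Qed.

Lemma exists_minimum (P : nat -> Prop) : (exists t, P t) ->
  exists T, P T /\ forall t, P t -> (T <= t)%N.
Proof.
move=> [t Pt]; have ex : exists t, `[< P t >] by exists t; apply/asboolP.
case: (ex_minnP ex) => T /asboolP PT Tmin; exists T; split=> // t' Pt'.
by apply: Tmin; apply/asboolP.
Qed.

Lemma exists_convergence_time n m (x : 'I_n -> R) (u : strategy R m) t :
  converged (opinions x u t) -> exists T, is_convergence_time x u T /\ (T <= t)%N.
Proof.
move=> xt.
have [|T [PT Tmin]] := exists_minimum (fun t => converged (opinions x u t)).
  by exists t.
by exists T; split; [split|apply: Tmin].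
Qed.

Lemma optimal_convergence_time_le n m (x : 'I_n -> R) (u : strategy R m) t :
  converged (opinions x u t) ->
  forall T, is_optimal_convergence_time m x T -> (T <= t)%N.
Proof.
move=> /exists_convergence_time[T' [h T't]] T [_ Tmin].
exact: leq_trans (Tmin _ _ h) T't.
Qed.

Lemma exists_optimal_convergence_time n m (x : 'I_n -> R) (u : strategy R m) t :
  converged (opinions x u t) -> exists T, is_optimal_convergence_time m x T.
Proof.
move=> /exists_convergence_time[T' [h _]].
have [|T [PT Tmin]] := exists_minimum (fun T => exists u : strategy R m, is_convergence_time x u T).
  by exists T', u.
by exists T; split=> // u' T'' h'; apply: Tmin; exists u'.
Qed.

End Trajectories.

(** * The strategic agent cuts the chain, one pair per step *)

Section Cutting.
Context {R : realType} {k K l : nat} {c : nat -> nat}.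
Hypotheses (k300 : (300 <= k)%N) (Kk : (300 * K.+1 <= k ^ 2)%N).
(** With these values the first and the last pair leave exactly one chain agent at each end,
    together with the cluster there. *)
Hypotheses (c0 : c 0 = 1%N) (cK : c K = (k - 2)%N).
Hypothesis cS : forall t, (t < K)%N -> (c t + 8 <= c t.+1 <= c t + 2 * l)%N.
Local Notation n := (3 * k + 1)%N.

Lemma cut_index_ge1 t : (t <= K)%N -> (1 <= c t)%N.
Proof.
elim: t => [|t IH] tK; first by rewrite c0.
by have := cS t tK; have := IH (ltnW tK); lia.
Qed.

Lemma cut_index_le t : (t <= K)%N -> (c t <= k - 2)%N.
Proof.
have mono r : (t <= r)%N -> (r <= K)%N -> (c t <= c r)%N.
  elim: r => [|r IH]; first by rewrite leqn0 => /eqP ->.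
  rewrite leq_eqVlt => /predU1P[-> //|tr] rK.
  by have := cS r rK; have := IH tr (ltnW rK); lia.
by move=> tK; rewrite -cK mono.
Qed.

(* At time t <= K the strategic agent sits half-way between the chain agents c t
   and c t + 1, which thereby lose contact with the rest of the chain; afterwards it
   stays out of reach. *)
Definition cutting_position t : R := if (t <= K)%N then (c t)%:R + 1 / 2 else k%:R + 10.

Local Notation x := (guided_orbit n (dumbbell_pos k) cutting_position).
Local Notation X := (fun t => iter t (free_step n) (dumbbell_pos k) : nat -> R).

(** As one of four agents in the ball, the strategic agent at [c s + 1/2] moves the pair from about
    [c s] and [c s + 1] to about [c s + 1/8] and [c s + 7/8], out of sight of its outer neighbours.
    The tolerance [1/100] is that of the chain positions. *)
Definition cuts_off (y : nat -> R) s :=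
  sep n y (k + c s) ((c s)%:R - 1 + 1 / 100) ((c s)%:R + 1 / 8 - 1 / 100) /\
  sep n y (k + c s + 2) ((c s)%:R + 1 - 1 / 8 + 1 / 100) ((c s)%:R + 2 - 1 / 100).

(** The field [cs_ahead] says that all agents to the right of the latest pair still follow the
    undisturbed orbit [X]; at time 0, before any cut, this means all agents. *)
Record cutting_stage t : Prop := CuttingStage {
  cs_nondecr : nondecr n (x t);
  cs_within : within n (x t) (- (1 / 100)) (k%:R + 1 / 100);
  cs_ahead : forall j, t = 0%N \/ (k + c t.-1 + 2 <= j)%N -> (j < n)%N -> x t j = X t j;
  cs_cuts : forall s, (s < t)%N -> cuts_off (x t) s }.

Let meta t : (t <= K.+1)%N -> metastable k t (X t).
Proof. by move=> tK; apply: metastable_iter => //; nia. Qed.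

Let chain_pos t i : (t <= K.+1)%N -> (i <= k)%N ->
  i%:R - 1 / 100 <= X t (k + i)%N <= i%:R + 1 / 100.
Proof. by move=> tK; apply: (ms_chain_pos k300 _ (meta t tK)); nia. Qed.

Lemma cutting_stage0 : cutting_stage 0.
Proof.
have m := meta 0 (leq0n _).
have k0 : 0 < k%:R :> R by rewrite ltr0n; lia.
have k1 : k%:R^-1 <= 1 / 100 :> R.
  have : 300 <= k%:R :> R by rewrite (ler_nat _ 300).
  by rewrite -div1r ler_pdivrMr //; lra.
have k2 : 0 < k%:R^-1 :> R by rewrite invr_gt0.
split=> //; first exact: ms_nondecr m.
move=> j jn; rewrite /= /dumbbell_pos; case: ltnP => jk; first by lra.
case: leqP => j2; last by lra.
have : (j - k)%:R <= k%:R :> R by rewrite ler_nat; lia.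
by have := ler0n R (j - k); lra.
Qed.

Section Step.
Context {t : nat}.
Hypotheses (tK : (t <= K)%N) (st : cutting_stage t).

Let ct1 : (1 <= c t)%N := cut_index_ge1 t tK.
Let ctk : (c t <= k - 2)%N := cut_index_le t tK.

Let ball_ahead i j : (k + c t - 1 <= i)%N -> (i < n)%N -> (j < n)%N ->
  (`|x t i - x t j| <= 1) = (`|X t i - X t j| <= 1) /\
  (`|x t i - x t j| <= 1 -> x t j = X t j).
Proof.
have ct1' := ct1; have ctk' := ctk.
move=> ci i_n jn.
case: (posnP t) => [t0|t0]; first by rewrite t0.
have cc : (c t.-1 + 8 <= c t)%N by have := cS t.-1; rewrite prednK // => /(_ tK) /andP[].
have xi : x t i = X t i by apply: (cs_ahead _ st) => //; right; lia.
case: (leqP (k + c t.-1 + 2) j) => hj.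
  by rewrite xi (cs_ahead _ st j) //; right.
(* All agents that may be disturbed have an index below [q], hence lie to the left of
   [x t q = X t q] in both orbits, and [q] is at least two chain places to the left of [i]. *)
pose q := (k + c t.-1 + 2)%N.
have jq : (j <= q)%N by lia.
have qn : (q < n)%N by rewrite /q; lia.
have xq : x t q = X t q by apply: (cs_ahead _ st) => //; right; rewrite leqnn.
have tK' : (t <= K.+1)%N by lia.
have Xm := ms_nondecr _ _ _ (meta t tK').
have h1 := cs_nondecr _ st j q jq qn; rewrite xq in h1.
have h2 := Xm j q jq qn.
have h3 := Xm _ _ ci i_n.
have q3 : (q <= k + (c t - 3))%N by rewrite /q; lia.
have q3n : (k + (c t - 3) < n)%N by lia.
have h4 := Xm _ _ q3 q3n.
have c3k : (c t - 3 <= k)%N by lia.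
have c1k : (c t - 1 <= k)%N by lia.
have /andP[_ h5] := chain_pos t (c t - 3)%N tK' c3k.
have /andP[h6 _] := chain_pos t (c t - 1)%N tK' c1k.
have e3 : (c t - 3)%:R = (c t)%:R - 3 :> R by rewrite natrB //; lia.
have e1 : (c t - 1)%:R = (c t)%:R - 1 :> R by rewrite natrB.
have e1' : (k + (c t - 1) = k + c t - 1)%N by lia.
rewrite e3 in h5; rewrite e1 e1' in h6.
have far y : y <= X t q -> (`|X t i - y| <= 1) = false.
  by move=> yq; apply/negbTE; rewrite -ltNge ltr_normr; lra.
by rewrite xi !far.
Qed.

Let free_ahead i : (k + c t - 1 <= i)%N -> (i < n)%N ->
  free_step n (x t) i = X t.+1 i.
Proof.
move=> ci i_n; apply: eq_ball_avg => j; have [h1 h2] := ball_ahead i j ci i_n (ltn_ord j).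
  exact: h1.
exact: h2.
Qed.

Let pos_ahead i : (k + c t - 1 <= i)%N -> (i < n)%N -> x t i = X t i.
Proof.
move=> ci i_n; have [_ h] := ball_ahead i i ci i_n i_n.
by apply: h; apply: ball_center.
Qed.

Let s_t : cutting_position t = (c t)%:R + 1 / 2.
Proof. by rewrite /cutting_position tK. Qed.

Let guided_far i : (k + c t - 1 <= i)%N -> (i < n)%N ->
  i = (k + c t - 1)%N \/ (k + c t + 2 <= i)%N -> x t.+1 i = X t.+1 i.
Proof.
have ct1' := ct1; have ctk' := ctk.
move=> ci i_n hi; rewrite -free_ahead // [LHS]/=; apply: guided_step_far.
rewrite pos_ahead // s_t ltr_normr.
have tK' : (t <= K.+1)%N by lia.
case: hi => hi.
  have c1k : (c t - 1 <= k)%N by lia.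
  have /andP[_] := chain_pos t (c t - 1)%N tK' c1k.
  have -> : (k + (c t - 1))%N = i by lia.
  by rewrite natrB //; lra.
have c2k : (c t + 2 <= k)%N by lia.
have /andP[h _] := chain_pos t (c t + 2)%N tK' c2k.
have c2i : (k + (c t + 2) <= i)%N by lia.
have := ms_nondecr _ _ _ (meta t tK') _ _ c2i i_n.
by rewrite natrD in h; lra.
Qed.

Let guided_near i : i = (k + c t)%N \/ i = (k + c t).+1 ->
  x t.+1 i = (3 * X t.+1 i + ((c t)%:R + 1 / 2)) / 4.
Proof.
have ct1' := ct1; have ctk' := ctk.
move=> hi; have ci : (k + c t - 1 <= i)%N by lia.
have i_n : (i < n)%N by lia.
have tK' : (t <= K.+1)%N by lia.
have iE : exists2 d, (d <= 1)%N & i = (k + (c t + d))%N.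
  by case: hi => ->; [exists 0%N|exists 1%N] => //; lia.
have near : `|X t i - ((c t)%:R + 1 / 2)| <= 1.
  have [d d1 ->] := iE; have ck : (c t + d <= k)%N by lia.
  have := chain_pos t _ tK' ck; rewrite natrD.
  have : d%:R <= 1 :> R by rewrite lern1.
  by have := ler0n R d; rewrite ler_norml => ? ? /andP[? ?]; apply/andP; split; lra.
have size3 : \sum_(j < n | `|x t i - x t j| <= 1) (1 : R) = 3.
  have E (j : 'I_n) : (`|x t i - x t j| <= 1) = (`|X t i - X t j| <= 1).
    by have [] := ball_ahead i j ci i_n (ltn_ord j).
  rewrite (eq_bigl _ _ E); apply: (ms_ball_chain_size k300 _ (meta t tK')); first by nia.
  by lia.
rewrite /= s_t /guided_step (ball_avg_profile_near _ _ _ _ (Ordinal i_n)); last first.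
- by rewrite pos_ahead.
- exact: ball_center.
rewrite size3 -/(free_step n (x t) i) free_ahead //.
by have -> : 3 + 1 = 4 :> R by lra.
Qed.

Lemma cutting_stage_step : cutting_stage t.+1.
Proof.
have ct1' := ct1; have ctk' := ctk.
have xm : nondecr n (x t.+1) by apply: guided_step_nondecr; exact: cs_nondecr st.
have tK' : (t.+1 <= K.+1)%N by [].
have ck : (c t)%:R + 2 <= k%:R :> R by rewrite -natrD ler_nat; lia.
have cpos : 0 <= (c t)%:R :> R by rewrite ler0n.
split=> //.
- apply: guided_step_within; last exact: cs_within st.
  by rewrite s_t; apply/andP; split; lra.
- move=> j [//|/= hj] jn; apply: guided_far => //; [lia|by right].
move=> s; rewrite ltnS leq_eqVlt => /predU1P[->|st'].
  split; split=> [i ip|j pj jn].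
  - have h1 : (i <= k + c t - 1)%N by lia.
    have h2 : (k + c t - 1 < n)%N by lia.
    apply: (le_trans (xm _ _ h1 h2)).
    rewrite guided_far //; last by left.
    have c1k : (c t - 1 <= k)%N by lia.
    have /andP[_] := chain_pos t.+1 (c t - 1)%N tK' c1k.
    have -> : (k + (c t - 1) = k + c t - 1)%N by lia.
    by rewrite natrB.
  - apply: le_trans (xm _ _ pj jn).
    rewrite guided_near; last by left.
    have c1k : (c t <= k)%N by lia.
    by have /andP[h _] := chain_pos t.+1 (c t) tK' c1k; lra.
  - have h1 : (i <= (k + c t).+1)%N by lia.
    have h2 : ((k + c t).+1 < n)%N by lia.
    apply: (le_trans (xm _ _ h1 h2)).
    rewrite guided_near; last by right.
    have c1k : (c t + 1 <= k)%N by lia.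
    have /andP[_] := chain_pos t.+1 (c t + 1)%N tK' c1k.
    have -> : (k + (c t + 1) = (k + c t).+1)%N by lia.
    by rewrite natrD => h; lra.
  - apply: le_trans (xm _ _ pj jn).
    rewrite guided_far; [|lia|lia|by right].
    have c1k : (c t + 2 <= k)%N by lia.
    have /andP[] := chain_pos t.+1 (c t + 2)%N tK' c1k.
    have -> : (k + (c t + 2) = k + c t + 2)%N by lia.
    by rewrite natrD => h _; lra.
(* Older cuts persist, because the strategic agent is now to the right of them. *)
have [h1 h2] := cs_cuts _ st s st'.
have cs : (c s + 8 <= c t)%N.
  have : forall r, (s < r)%N -> (r <= K)%N -> (c s + 8 <= c r)%N.
    elim=> // r IH; rewrite ltnS leq_eqVlt => /predU1P[<-|sr] rK.
      by case/andP: (cS s rK).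
    by have := IH sr (ltnW rK); case/andP: (cS r rK); lia.
  by apply.
have cs' : (c s)%:R + 8 <= (c t)%:R :> R by rewrite -natrD ler_nat.
have csk : (k + c s + 2 <= n)%N by lia.
by split; apply: guided_step_sep => //; rewrite ?s_t; lra || lia.
Qed.

End Step.

Lemma cutting_stage_le t : (t <= K.+1)%N -> cutting_stage t.
Proof.
elim: t => [|t IH] tK; first exact: cutting_stage0.
by apply: cutting_stage_step => //; apply: IH; apply: ltnW.
Qed.

End Cutting.

(** * Convergence of the pieces once the chain is cut *)

Section AfterCutting.
Context {R : realType}.

Lemma narrow_converges n (y : nat -> R) a b N : (0 < N)%N -> (b <= n)%N -> nondecr n y ->
  cut n y a -> cut n y b -> narrow y a b -> converged_on (iter N (free_step n) y) a b.
Proof.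
case: N => // N _ bn ym ya yb yab; rewrite iterSr.
apply: iter_free_step_converged_on => //; first exact: free_step_nondecr.
- exact: free_step_cut.
- exact: free_step_cut.
exact: narrow_merge.
Qed.

(** Of two indices, the smaller one provides the block; the larger one lies either in it or beyond
    its right cut. *)
Lemma converged_on_blocks n (z : nat -> R) :
  (forall i, (i < n)%N -> exists a b,
     [/\ (a <= i < b)%N, cut n z b & converged_on z a b]) -> converged_on z 0 n.
Proof.
move=> blocks.
have le i j : (i <= j)%N -> (j < n)%N -> z i = z j \/ 1 < `|z i - z j|.
  move=> ij jn; have [a [b [iab zb zc]]] := blocks i (leq_ltn_trans ij jn).
  case: (ltnP j b) => jb; first by apply: zc => //; lia.
  have ib : (i < b)%N by lia.
  by right; have := zb i j ib jb jn; rewrite ltr_normr; lra.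
move=> i j /= i_n jn; case: (leqP i j) => ij; first exact: le.
by rewrite distrC; case: (le j i (ltnW ij) i_n) => [->|]; [left|right].
Qed.

Lemma cutting_converges {k K l c} : (300 <= k)%N -> (300 * K.+1 <= k ^ 2)%N ->
  c 0 = 1%N -> c K = (k - 2)%N ->
  (forall t, (t < K)%N -> (c t + 8 <= c t.+1 <= c t + 2 * l)%N) -> (2 <= l)%N ->
  converged_on (guided_orbit (3 * k + 1) (dumbbell_pos k) (@cutting_position R k K c)
    (K.+1 + (17 * l ^ 3).*2)) 0 (3 * k + 1).
Proof.
move=> k300 Kk c0 cK cS l2; set n := (3 * k + 1)%N; set N := (17 * l ^ 3)%N.
have st := @cutting_stage_le R k K l c k300 Kk c0 cK cS K.+1 (leqnn _).
set y := guided_orbit n (dumbbell_pos k) (@cutting_position R k K c) K.+1.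
have ym : nondecr n y := cs_nondecr _ st.
have yw : within n y (- (1 / 100)) (k%:R + 1 / 100) := cs_within _ st.
have far t : (K.+1 <= t)%N -> k%:R + 1 / 100 + 1 < @cutting_position R k K c t.
  by move=> Kt; rewrite /cutting_position leqNgt Kt /=; lra.
have freeE i : (i < n)%N -> _ := guided_orbit_far _ _ _ _ _ _ N.*2 yw far i.
suff zc : converged_on (iter N.*2 (free_step n) y) 0 n.
  by move=> i j hi hj; rewrite !freeE //; apply: zc.
have N0 : (0 < N.*2)%N by rewrite double_gt0 muln_gt0 expn_gt0; lia.
have off s : (s <= K)%N -> @cuts_off R k c y s by move=> sK; apply: (cs_cuts _ st); rewrite ltnS.
have cut1 s : (s <= K)%N -> cut n y (k + c s).
  by move=> /off[h _]; apply: sep_cut h; lra.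
have cut2 s : (s <= K)%N -> cut n y (k + c s + 2).
  by move=> /off[_ h]; apply: sep_cut h; lra.
have c1 s : (s <= K)%N -> (1 <= c s)%N := cut_index_ge1 k300 Kk c0 cK cS s.
have ck s : (s <= K)%N -> (c s <= k - 2)%N := cut_index_le k300 Kk c0 cK cS s.
apply: converged_on_blocks => i i_n.
suff [a [b [iab bn ya yb zab]]] : exists a b, [/\ (a <= i < b)%N, (b <= n)%N, cut n y a,
    cut n y b & converged_on (iter N.*2 (free_step n) y) a b].
  by exists a, b; split=> //; apply: iter_free_step_cut.
(* Four kinds of blocks: the left cluster with its chain agent, the right one with its own, a pair,
   and a stretch between two pairs. All but the last have diameter at most 1. *)
case: (leqP i k) => ik.
  have cut0 : cut n y k.+1 by have := cut1 0%N (leq0n _); rewrite c0 addn1.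
  exists 0%N, k.+1; split=> //; first by lia.
  apply: narrow_converges => //; first by lia.
  have y0 j : (0 <= j < k.+1)%N -> - (1 / 100) <= y j <= 1 / 100.
    move=> jk; have jn : (j < n)%N by lia.
    have [[h _] _] := off 0%N (leq0n _); have /andP[-> _] := yw j jn.
    have := h j; rewrite c0 addn1 => /(_ jk).
    by rewrite subrr add0r.
  by move=> j j' /y0 /andP[? ?] /y0 /andP[? ?]; rewrite ler_norml; lra.
case: (leqP (2 * k) i) => i2.
  have kE : (k + c K + 2 = 2 * k)%N by rewrite cK; lia.
  have cutk : cut n y (2 * k) by rewrite -kE; apply: cut2.
  have cutn : cut n y n by move=> ? j _ nj; rewrite ltnNge nj.
  exists (2 * k)%N, n; split=> //; first by rewrite i2.
  apply: narrow_converges => //.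
  have yk j : (2 * k <= j < n)%N -> k%:R - 1 / 100 <= y j <= k%:R + 1 / 100.
    move=> /andP[jk jn]; have [_ [_ h]] := off K (leqnn _); have /andP[_ ->] := yw j jn.
    rewrite kE cK in h; have := h j jk jn; rewrite natrB; last by lia.
    by lra.
  by move=> j j' /yk /andP[? ?] /yk /andP[? ?]; rewrite ler_norml; lra.
have [s [sK csi si]] : exists s, [/\ (s <= K)%N, (k + c s <= i)%N &
   (s < K)%N -> (i < k + c s.+1)%N].
  have ex : exists s, (s <= K)%N && (k + c s <= i)%N by exists 0%N; rewrite c0; lia.
  have ub s : (s <= K)%N && (k + c s <= i)%N -> (s <= K)%N by case/andP.
  case: (ex_maxnP ex ub) => s /andP[sK csi] smax; exists s; split=> // sK'.
  by rewrite ltnNge; apply/negP => h; have := smax s.+1; rewrite sK' h ltnn => /(_ isT).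
case: (ltnP i (k + c s + 2)) => i3.
  exists (k + c s)%N, (k + c s + 2)%N; split; [lia|have := ck s sK; lia|exact: cut1|exact: cut2|].
  have [[_ h1] [h2 _]] := off s sK.
  apply: narrow_converges => //; [have := ck s sK; lia|exact: cut1|exact: cut2|].
  have ys j : (k + c s <= j < k + c s + 2)%N ->
     (c s)%:R + 1 / 8 - 1 / 100 <= y j <= (c s)%:R + 1 - 1 / 8 + 1 / 100.
    by have := ck s sK => ? /andP[? ?]; rewrite h1 ?h2 //; lia.
  by move=> j j' /ys /andP[? ?] /ys /andP[? ?]; rewrite ler_norml; lra.
have sK' : (s < K)%N.
  by rewrite ltn_neqAle sK andbT; apply: contraTneq i3 => ->; rewrite cK; lia.
have i4 := si sK'; have := cS s sK' => /andP[h1 h2].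
have ckS := ck s.+1 sK'.
exists (k + c s + 2)%N, (k + c s.+1)%N; split; [lia|lia|exact: cut2|exact: cut1|].
apply: (@block_converges _ _ _ _ _ (2 * l) _ (2 * l)%:R) => //; [lia|lia|exact: cut2|exact: cut1| |].
  move=> ab.
  have [_ [_ h3]] := off s sK; have [[h4 _] _] := off s.+1 sK'.
  have h5 : y (k + c s.+1).-1 <= (c s.+1)%:R - 1 + 1 / 100 by apply: h4; lia.
  have h6 : (c s)%:R + 2 - 1 / 100 <= y (k + c s + 2)%N by apply: h3; lia.
  have : (c s.+1)%:R <= (c s)%:R + (2 * l)%:R :> R by rewrite -natrD ler_nat.
  by lra.
(* With [M = D = 2 l] the required bound is [2 l + 16 l^3 < 17 l^3], true for [l >= 2]. *)
rewrite -natrX -!natrM -natrD ltr_nat /N; nia.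
Qed.

End AfterCutting.

(** * The two rates *)

Section Rates.
Context {R : realType}.

(** In the metastable state the first two chain agents are at a distance between [99/100] and 1,
    which rules out convergence. *)
Lemma dumbbell_free_time_ge k t : (300 <= k)%N ->
  converged (opinions (dumbbell R k) no_strategic_agent t) -> (k ^ 2 <= 300 * t)%N.
Proof.
move=> k300; rewrite (opinions_free _ (dumbbell_pos k)) => xc.
rewrite leqNgt; apply/negP => tk.
have ms := metastable_iter (R := R) k t k300 (ltnW tk).
have k0 : (0 < k)%N by lia.
have kn : (k < 3 * k + 1)%N by lia.
have k1n : (k.+1 < 3 * k + 1)%N by lia.
have := ms_gap_small k300 (ltnW tk) ms 0%N k0; rewrite addn0.
have := xc (Ordinal kn) (Ordinal k1n); rewrite /= ltr_normr.
by case=> [?|/orP[] ?] /andP[? ?]; lra.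
Qed.

Lemma dumbbell_cutting_time k l : (8 <= l)%N -> (l ^ 4 <= k < l.+1 ^ 4)%N ->
  exists u : strategy R 1, exists2 t, converged (opinions (dumbbell R k) u t) & (t <= 51 * l ^ 3)%N.
Proof.
move=> l8 /andP[lk kl]; pose K := ((k - 3) %/ l)%N.
have l0 : (0 < l)%N by lia.
have l43 : (l ^ 4 = l ^ 3 * l)%N by rewrite -expnSr.
have l3 : (64 * l <= l ^ 3)%N by rewrite !expnS expn0; nia.
have k512 : (512 * l <= k)%N by nia.
have Kl : (K * l <= k - 3)%N by apply: leq_divM.
have lK : (k - 3 < K.+1 * l)%N by rewrite mulSnr; have := ltn_ceil (k - 3) l0; lia.
have kl' : (k < 16 * l ^ 4)%N.
  apply: leq_trans kl _; have -> : (16 * l ^ 4 = (2 * l) ^ 4)%N by rewrite expnMn.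
  by rewrite leq_exp2r //; lia.
have K16 : (K < 16 * l ^ 3)%N by nia.
have K0 : (0 < K)%N by nia.
(* Cuts are [l] apart, except that the last spacing also takes the remainder of the division and so
   lies between [l] and [2 l]. *)
pose c t := if (t < K)%N then (1 + l * t)%N else (k - 2)%N.
have cS t : (t < K)%N -> (c t + 8 <= c t.+1 <= c t + 2 * l)%N.
  move=> tK; rewrite /c tK; case: ltnP => h; first by nia.
  have tE : t.+1 = K by lia.
  have : (K * l = l * t + l)%N by rewrite -tE mulSnr mulnC.
  by rewrite mulSnr in lK; lia.
have c0 : c 0 = 1%N by rewrite /c K0 muln0.
have cK : c K = (k - 2)%N by rewrite /c ltnn.
have k300 : (300 <= k)%N by lia.
have Kk : (300 * K.+1 <= k ^ 2)%N by nia.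
have conv := cutting_converges (R := R) k300 Kk c0 cK cS (ltnW (ltnW (ltnW (ltnW (ltnW (ltnW l8)))))).
(* At most [16 l^3] cutting steps are followed by [34 l^3] free ones. *)
exists (fun t _ => @cutting_position R k K c t); exists (K.+1 + (17 * l ^ 3).*2)%N; last by lia.
by rewrite (opinions_guided _ (dumbbell_pos k)); apply: converged_onP.
Qed.

Lemma pow3_le_powR (l k : nat) : (l ^ 4 <= k)%N -> l%:R ^+ 3 <= (k%:R : R) `^ (3 / 4).
Proof.
move=> lk; have l0 : 0 <= l%:R :> R by [].
have -> : l%:R ^+ 3 = (l%:R ^+ 4) `^ (3 / 4) :> R.
  by rewrite -!powR_mulrn // -powRrM; congr (_ `^ _); lra.
apply: ge0_ler_powR; rewrite ?nnegrE ?exprn_ge0 //.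
by rewrite -natrX ler_nat.
Qed.

Lemma exists_fourth_root k : exists l, (l ^ 4 <= k < l.+1 ^ 4)%N.
Proof.
have ex : exists l, (l ^ 4 <= k)%N by exists 0%N.
have ub l : (l ^ 4 <= k)%N -> (l <= k)%N.
  by move=> h; apply: leq_trans h; case: l => // l; rewrite -{1}[l.+1]expn1 leq_pexp2l.
case: (ex_maxnP ex ub) => l lk lmax; exists l; rewrite lk /= ltnNge; apply/negP => h.
by have := lmax _ h; rewrite ltnn.
Qed.

End Rates.

Theorem lemma11 (R : realType) :
  exists T0 T1 : nat -> nat,
    [/\ forall k : nat, (10 <= k)%N ->
          is_convergence_time (dumbbell R k) no_strategic_agent (T0 k),
        forall k : nat, (10 <= k)%N ->
          is_optimal_convergence_time 1 (dumbbell R k) (T1 k),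
        (fun k : nat => (T0 k)%:R : R^o)
          \is 'Omega_\oo (fun k : nat => ((3 * k + 1)%N%:R ^+ 2) : R^o)
      & (fun k : nat => (T1 k)%:R : R^o)
          =O_\oo (fun k : nat => ((3 * k + 1)%N%:R `^ (3 / 4)) : R^o)].
Proof.
have free_conv k : (10 <= k)%N ->
    exists t, converged_on (iter t (free_step (3 * k + 1)) (dumbbell_pos k : nat -> R)) 0 (3 * k + 1).
  move=> k10; apply: free_orbit_converges.
  by apply: ms_nondecr (metastable_dumbbell k _); lia.
have /choice[T0 hT0] : forall k, exists T, (10 <= k)%N ->
    is_convergence_time (dumbbell R k) no_strategic_agent T.
  (* The value 0 for [k < 10] is a placeholder. *)
  move=> k; case: (leqP 10 k) => k10; last by exists 0%N.
  have [t ct] := free_conv k k10.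
  have [|T [hT _]] := exists_convergence_time _ _ (dumbbell R k) no_strategic_agent t.
    by rewrite (opinions_free _ (dumbbell_pos k)); apply: converged_onP.
  by exists T.
have /choice[T1 hT1] : forall k, exists T, (10 <= k)%N ->
    is_optimal_convergence_time 1 (dumbbell R k) T.
  move=> k; case: (leqP 10 k) => k10; last by exists 0%N.
  have [t ct] := free_conv k k10.
  have x0w : within (3 * k + 1) (dumbbell_pos k : nat -> R) (dumbbell_pos k 0%N) (dumbbell_pos k (3 * k)%N).
    have m : nondecr (3 * k + 1) (dumbbell_pos k : nat -> R).
      by apply: ms_nondecr (metastable_dumbbell k _); lia.
    by move=> j jn; rewrite !m //; lia.
  (* A strategic agent parked out of sight reproduces the free orbit; so some strategy converges and
     the minimum exists. *)
  pose s (t : nat) : R := dumbbell_pos k (3 * k)%N + 2.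
  have far (t' : nat) : (0 <= t')%N -> dumbbell_pos k (3 * k)%N + 1 < s t'.
    by move=> _; rewrite /s; lra.
  have [|T hT] := @exists_optimal_convergence_time R _ 1 (dumbbell R k) (fun t _ => s t) t.
    rewrite (opinions_guided _ (dumbbell_pos k)); apply: converged_onP => i j hi hj.
    have orbitE := guided_orbit_far _ _ s _ _ 0%N t x0w far; rewrite add0n in orbitE.
    by rewrite !orbitE //; apply: ct.
  by exists T.
exists T0, T1; split=> //.
(* The constant comes from [(3 k + 1)^2 <= 16 k^2] and [k^2 <= 300 T0]. *)
- rewrite qualifE; apply/asboolP; exists (1 / 4800); first by lra.
  exists 300%N => //= k k300.
  have k10 : (10 <= k)%N by apply: leq_trans k300.
  have := dumbbell_free_time_ge k (T0 k) k300 (proj1 (hT0 k k10)).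
  rewrite -(ler_nat R) => h.
  rewrite !ger0_norm // ?exprn_ge0 //.
  have k1 : 1 <= k%:R :> R by rewrite ler1n; lia.
  have : (3 * k + 1)%:R = 3 * k%:R + 1 :> R by rewrite natrD natrM.
  move: h; rewrite natrX natrM => h ->; nra.
- apply/eqO_exP; exists 51; first by lra.
  (* This threshold makes the integer fourth root [l] of [k] at least 8, as [dumbbell_cutting_time]
     requires. *)
  exists (8 ^ 4)%N => //= k k8.
  have [l lk] := exists_fourth_root k.
  have l8 : (8 <= l)%N.
    by rewrite -ltnS -(ltn_exp2r _ _ (_ : 0 < 4)%N) //; apply: leq_ltn_trans k8 _; case/andP: lk.
  have k10 : (10 <= k)%N by apply: leq_trans k8.
  have [u [t ut tl]] := dumbbell_cutting_time (R := R) k l l8 lk.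
  have Tt := leq_trans (optimal_convergence_time_le _ _ _ u t ut _ (hT1 k k10)) tl.
  rewrite !ger0_norm ?powR_ge0 //.
  apply: (@le_trans _ _ (51 * l%:R ^+ 3)); first by rewrite -natrX -natrM ler_nat.
  apply: ler_wpM2l; first by lra.
  by apply: pow3_le_powR; case/andP: lk; lia.
Qed.
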